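(* Let $\alpha\in(0,1)$, $s>1$ be real and $K\geq1$ an integer. Given any nested sequence of spaces $V_1\subset\cdots\subset V_K\subset L^2(X,\rho)$, $V_k=\mathrm{span}\{\psi_1,\ldots,\psi_{n_k}\}$, with dimensions $n_1<\cdots<n_K$, if $$m_k=\tau_k n_k,\qquad \tau_k:=\left\lceil\theta^{-1}\ln\left(\frac{\zeta(s)\,n_k^{s+1}}{\alpha}\right)\right\rceil,\quad k=1,\ldots,K,$$ then (i) $\Pr\left(\bigcap_{k=1}^K\left\{\|G_k-I_k\|_2\leq\frac12\right\}\right)\geq1-\alpha$, where $G_k\in\mathbb{R}^{n_k\times n_k}$ is defined by $(G_k)_{pq}=m_k^{-1}\sum_{j=1}^{m_k}\psi_p(x^j)\psi_q(x^j)$ and $x^1,\ldots,x^{m_K}$ is a set of $m_K$ independent random samples such that for any $k=1,\ldots,K$ and any $j=1,\ldots,n_k$ the samples $x^{(j-1)\tau_k+1},\ldots,x^{j\tau_k}$ are distributed according to $\chi_j$ (such a set can be generated sequentially, recycling all samples from previous iterations, by adding at step $k$ $\tau_k-\tau_{k-1}$ new samples from $\chi_j$ for each $j\leq n_{k-1}$ and $\tau_k$ samples from $\chi_j$ for each $n_{k-1}<j\leq n_k$); (ii) if $u\in L^2(X,\rho)$ then for any $k=1,\ldots,K$, $\mathbb{E}(\|u-u_C^k\|^2)\leq\left(1+\frac{4\theta}{\ln(\zeta(s)n_k^{s+1}/\alpha)}\right)e_{n_k,2}(u)^2+\alpha\|u\|^2$.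
   Context: $X\subseteq\mathbb{R}^d$ Borel, $\rho$ a Borel probability measure, $(\psi_i)_{i\geq1}$ an orthonormal basis of $L^2(X,\rho)$ (norm $\|\cdot\|$), with the spaces such that for each $x$ some basis function in $V_1$ is nonzero at $x$. $\chi_j(A)=\int_A|\psi_j|^2d\rho$. $\theta=\frac{3\ln(3/2)-1}{2}\approx0.108$, $\zeta$ the Riemann zeta function, $I_k$ the $n_k\times n_k$ identity, $\|\cdot\|_2$ the spectral norm. For space $V_k$: weight $w_k(x)=n_k/\sum_{i=1}^{n_k}|\psi_i(x)|^2$, discrete seminorm $\|f\|_{m_k}^2=\frac1{m_k}\sum_{i=1}^{m_k}w_k(x^i)f(x^i)^2$ using the first $m_k$ samples, $u_W^k=\arg\min_{v\in V_k}\|u-v\|_{m_k}$, $u_C^k=u_W^k$ if $\|G_k-I_k\|_2\leq\frac12$ and $0$ otherwise, and $e_{n_k,2}(u)=\min_{v\in V_k}\|u-v\|$.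
   Formalization: G_k carries the weight w_k(x^j) in each summand (without it (i) is false), and the samples are indexed by pairs (j,t), level k using τ_k samples from each χ_j, j ≤ n_k, since one fixed ordering x^1,…,x^{m_K} cannot meet the stated law for all k. *)

(* Defs.v *)
From mathcomp Require Import all_boot all_order all_algebra.
From mathcomp Require Import all_classical all_reals all_analysis.
Import Order.TTheory GRing.Theory Num.Theory.
Import numFieldNormedType.Exports.

Set Implicit Arguments.
Unset Strict Implicit.
Unset Printing Implicit Defensive.

Local Open Scope classical_set_scope.
Local Open Scope ring_scope.

Section Defs.
Context {R : realType}.

Definition theta : R := (3 * ln (3 / 2) - 1) / 2.

Definition zeta (s : R) : R := \big[+%R/0%R]_(1 <= k <oo) ((k%:R) `^ (- s)).

Definition tau (s alpha : R) (n : nat) : nat :=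
  `| Num.ceil (theta^-1 * ln (zeta s * (n%:R `^ (s + 1)) / alpha)) |%N.

Context {d : measure_display} {T : measurableType d}.

(* element of V_n = span{psi_1,...,psi_n} (0-indexed: psi 0, ..., psi (n-1)) *)
Definition spanf (psi : nat -> T -> R) (n : nat) (c : nat -> R) (x : T) : R :=
  \sum_(i < n) c i * psi i x.

Definition ONB (rho : probability T R) (psi : nat -> T -> R) : Prop :=
  [/\ (forall i, measurable_fun setT (psi i)),
      (forall i j, (\int[rho]_x (psi i x * psi j x)%:E = ((i == j)%:R)%:E)%E) &
      (forall f : T -> R, measurable_fun setT f ->
         (\int[rho]_x ((f x) ^+ 2)%:E < +oo)%E ->
         (forall i, (\int[rho]_x (f x * psi i x)%:E = 0)%E) ->
         {ae rho, forall x, f x = 0})].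

Definition L2 (rho : probability T R) (u : T -> R) : Prop :=
  measurable_fun setT u /\ (\int[rho]_x ((u x) ^+ 2)%:E < +oo)%E.

Definition chi (rho : probability T R) (psi : nat -> T -> R) (j : nat) (A : set T)
  : \bar R := (\int[rho]_(x in A) ((psi j x) ^+ 2)%:E)%E.

Definition weight (psi : nat -> T -> R) (n : nat) (x : T) : R :=
  n%:R / \sum_(i < n) (psi i x) ^+ 2.

(* Samples are indexed by pairs (j,t): sample number t (t < tau) drawn from chi_j.
   At level k the samples used are those with j < n_k and t < tau_k
   (m_k = tau_k * n_k of them). *)

Definition gram (psi : nat -> T -> R) (n tau : nat) (x : nat -> nat -> T)
  : 'M[R]_n :=
  \matrix_(p < n, q < n)
    ((n * tau)%:R^-1 * \sum_(j < n) \sum_(t < tau)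
       weight psi n (x j t) * psi p (x j t) * psi q (x j t)).

Definition dnorm2 (psi : nat -> T -> R) (n tau : nat) (x : nat -> nat -> T)
  (f : T -> R) : R :=
  (n * tau)%:R^-1 * \sum_(j < n) \sum_(t < tau) weight psi n (x j t) * (f (x j t)) ^+ 2.

Definition err2 (rho : probability T R) (psi : nat -> T -> R) (n : nat) (u : T -> R)
  : \bar R :=
  ereal_inf [set (\int[rho]_x ((u x - spanf psi n c x) ^+ 2)%:E)%E | c in [set: nat -> R]].

End Defs.

Definition eucl {R : realType} {n : nat} (v : 'cV[R]_n) : R :=
  Num.sqrt (\sum_(i < n) (v i 0) ^+ 2).

Definition specnorm {R : realType} {n : nat} (A : 'M[R]_n) : R :=
  sup [set eucl (A *m v) | v in [set v : 'cV[R]_n | eucl v = 1]].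

Definition independent {R : realType} {dO : measure_display} {Omega : measurableType dO}
  {d : measure_display} {T : measurableType d} {I : finType}
  (P : probability Omega R) (X : I -> Omega -> T) : Prop :=
  forall A : I -> set T, (forall i, measurable (A i)) ->
    P (\bigcap_(i in [set: I]) (X i @^-1` A i)) = (\prod_(i : I) fine (P (X i @^-1` A i)))%:E.

(* Main.v *)
Require Import Defs.
From HB Require Import structures.
From mathcomp Require Import all_boot all_order all_algebra.
From mathcomp Require Import all_classical all_reals all_analysis.
From mathcomp Require Import complex measurable_realfun ring lra.
Import Order.TTheory GRing.Theory Num.Theory.
Import numFieldNormedType.Exports.
Local Open Scope classical_set_scope.
Local Open Scope ring_scope.

(* For a sample point [x] let [Q(x)] be the orthogonal projection onto the line spanned by
   [(psi_1(x), ..., psi_n(x))], so that [tau G] is the sum of the [Q] of the samples. These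
   are independent, but not identically distributed; only their means add up to [tau I].
   By Lieb's concavity theorem, [E tr exp (H + lam Q) <= tr exp (H + (e^lam - 1) E Q)]
   whatever the symmetric matrix [H], so the trace of the matrix moment generating function
   of [tau G] is at most [n exp ((e^lam - 1) tau)], and Markov's inequality at
   [e^lam = 3/2] and [e^lam = 1/2] gives
   [Pr (|G - I| > 1/2) <= n (exp (-theta tau) + exp (-theta' tau))] with [theta' >= 4/3 theta].

   A union bound with [2 n exp (-theta tau)] would lose a factor 2. It is recovered
   because [G = I] when [n = 1], and because the second exponential contributes at most
   [alpha zeta^(-4/3) sum_(n >= 2) n^(-p)] in total, [p = s + (s+1)/3], which is below the
   term [alpha / zeta] saved at [n = 1].

   For the risk, the normal equations read [G e = g], where [e] is the coefficient error and
   [g] the discrete inner products of the residual with the basis; [|e| <= 2 |g|] on the good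
   event, and [E |g|^2 <= err^2 / tau] because the means of the samples add up to zero. *)

Set Implicit Arguments.
Unset Strict Implicit.
Unset Printing Implicit Defensive.

(** Concavity is used neither through derivatives nor through Jensen's inequality, but as a
    supporting hyperplane [A |-> tr (M A)], into which an expectation is inserted by linearity.
    Lieb's theorem comes from the Gibbs formula $tr exp (H + log A) = max_X (tr (H X) + tr A - D(X,
    A))$, with $D$ the matrix relative entropy. $D$ is an integral over $[0,1]$ of
    quadratic-over-linear functions, each a maximum of functions linear in $(A, X)$; freezing the
    maximiser at a base point and integrating gives the hyperplane. Positive definite matrices are
    written throughout as exponentials of symmetric ones.

    Two obstacles shape the probabilistic part. Independence is given on product sets only, so in
    the induction over the samples the remaining ones are represented by [Omega] itself with the
    sigma-algebra that they generate. And the least squares coefficients are arbitrary functions of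
    the outcome, so the risk integrand need not be measurable; it is bounded pointwise by a
    measurable function before anything is integrated. *)

(** * Spectral theorem for real symmetric matrices *)

Lemma symmetric_eigenvalue (R : realType) (n : nat) (A : 'M[R]_n.+1) :
  A^T = A -> exists a : R, eigenvalue A a.
Proof.
move=> sA; pose f := real_complex R; pose Ac : 'M[R[i]]_n.+1 := map_mx f A.
have rf x : f x \is Num.real by rewrite /f complex_real.
have hA : Ac \is hermsymmx.
  apply: realsym_hermsym.
    by apply/is_hermitianmxP; rewrite expr0 scale1r map_mx_id// /Ac map_trmx sA.
  by apply/mxOverP => i j; rewrite mxE.
have := hermitian_spectral_diag_real hA => /mxOverP /(_ 0 0) ra.
have [a Ea] : exists a : R, spectral_diag Ac 0 0 = f a.
  by move/complex_realP: ra => [a ->]; exists a.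
(* Being an eigenvalue is unaffected by the extension from [R] to [R[i]], so a complex eigenvector
   for the real value [a] is enough. *)
exists a; rewrite -(eigenvalue_map f); change (eigenvalue Ac (f a)); rewrite -Ea.
have := orthomx_spectralP (hermitian_normalmx hA); set S := spectralmx Ac => E.
apply/eigenvalueP; exists (row 0 S); last first.
  apply/negP => /eqP r0; have := spectral_unit Ac; rewrite -/S -row_free_unit.
  by move=> /row_freeP[B] /(congr1 (row 0)); rewrite row_mul r0 mul0mx => /rowP/(_ 0);
    rewrite !mxE eqxx => /esym/eqP; rewrite oner_eq0.
rewrite -row_mul E mulmxA mulmxA mulmxV ?spectral_unit// mul1mx row_mul.
by rewrite -E row_diag_mx -scalemxAl -rowE.
Qed.

Lemma row_sqnormE (R : realType) (n : nat) (v : 'rV[R]_n) :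
  (v *m v^T) 0 0 = \sum_i v 0 i ^+ 2.
Proof. by rewrite mxE; apply: eq_bigr => i _; rewrite mxE. Qed.

Lemma row_sqnorm_eq0 (R : realType) (n : nat) (v : 'rV[R]_n) :
  (v *m v^T) 0 0 = 0 -> v = 0.
Proof.
rewrite row_sqnormE => /eqP; rewrite psumr_eq0 => [/allP h|i _]; last exact: sqr_ge0.
apply/rowP => i; rewrite mxE; apply/eqP; rewrite -sqrf_eq0.
by apply: h; rewrite mem_index_enum.
Qed.

(** The reflection in the hyperplane orthogonal to [v - e] exchanges the unit vectors [v] and [e].
    It completes [v] to an orthonormal basis in closed form, without Gram-Schmidt. *)
Lemma unit_row_householder (R : realType) (n : nat) (v : 'rV[R]_n.+1) :
  v *m v^T = 1%:M ->
  exists Q : 'M[R]_n.+1, [/\ Q^T = Q, Q *m Q = 1%:M & delta_mx 0 0 *m Q = v].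
Proof.
move=> vv; pose e : 'rV[R]_n.+1 := delta_mx 0 0.
have ee : e *m e^T = 1%:M by rewrite /e trmx_delta mul_delta_mx; apply/matrixP => i j;
  rewrite !mxE !ord1.
have [-> | ve] := eqVneq v e; first by exists 1%:M; rewrite trmx1 !mulmx1.
have [w Ew] : exists w : 'rV[R]_n.+1, w = v - e by eexists.
have [s ws] : exists s : R, w *m w^T = s%:M by exists ((w *m w^T) 0 0); rewrite -mx11_scalar.
have s0 : s != 0.
  apply: contraNneq ve => s0; rewrite -subr_eq0; apply/eqP/row_sqnorm_eq0.
  by rewrite -Ew ws s0 mxE eqxx.
have [t ev] : exists t : R, e *m v^T = t%:M by exists ((e *m v^T) 0 0); rewrite -mx11_scalar.
have ve' : v *m e^T = t%:M by rewrite -[LHS]trmxK trmx_mul trmxK ev tr_scalar_mx.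
have st : s = 2 * (1 - t).
  have : s%:M = (2 * (1 - t))%:M :> 'M[R]_1.
    rewrite -ws Ew linearB /= mulmxBl !mulmxBr vv ee ev ve'.
    by rewrite -!raddfB /=; congr (_%:M); ring.
  by move=> /(congr1 (fun M : 'M[R]_1 => M 0 0)); rewrite !mxE eqxx !mulr1n.
exists (1%:M - (2 / s) *: (w^T *m w)); split.
- by rewrite linearB /= linearZ /= trmx_mul trmxK trmx1.
- rewrite mulmxBl !mulmxBr !mul1mx mulmx1 -scalemxAl -scalemxAr !mulmxA.
  rewrite -[w^T *m w *m w^T]mulmxA ws mul_mx_scalar -scalemxAl !scalerA.
  apply/matrixP => i j; rewrite !mxE; set x := \sum_(_ < _) _; field; exact: s0.
- rewrite -/e mulmxBr mulmx1 -scalemxAr mulmxA.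
  have -> : e *m w^T = (t - 1)%:M by rewrite Ew linearB /= mulmxBr ee ev -raddfB.
  rewrite mul_scalar_mx scalerA st.
  have -> : 2 / (2 * (1 - t)) * (t - 1) = -1.
    by field; move: s0; rewrite st mulf_eq0 negb_or => /andP[].
  by rewrite scaleN1r opprK Ew addrC subrK.
Qed.

(** Deflation: reflecting a unit eigenvector to the first coordinate vector clears the rest of the
    first row, symmetry clears the first column, and the induction handles the remaining block. *)
Lemma spectral_theorem (R : realType) (n : nat) (A : 'M[R]_n) : A^T = A ->
  exists U : 'M[R]_n, exists a : 'rV[R]_n,
    U *m U^T = 1%:M /\ A = U^T *m diag_mx a *m U.
Proof.
elim: n A => [|n IH] A sA.
  by exists 1%:M, 0; split; [rewrite trmx1 mulmx1 | apply/matrixP => -[]].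
have [a /eigenvalueP[v0 v0A v0n]] := symmetric_eigenvalue sA.
pose s := (v0 *m v0^T) 0 0.
have s0 : 0 < s.
  rewrite /s lt_def row_sqnormE sumr_ge0 ?andbT => [|i _]; last exact: sqr_ge0.
  by rewrite -row_sqnormE; apply: contra v0n => /eqP /row_sqnorm_eq0 ->.
pose v := (Num.sqrt s)^-1 *: v0.
have vv : v *m v^T = 1%:M.
  rewrite /v linearZ /= -scalemxAl -scalemxAr scalerA [v0 *m _]mx11_scalar -/s.
  rewrite scale_scalar_mx -invfM -expr2 sqr_sqrtr ?ltW// mulVf// gt_eqF//.
have vA : v *m A = a *: v by rewrite /v -scalemxAl v0A scalerA mulrC -scalerA.
have [Q [sQ QQ eQ]] := unit_row_householder vv.
have [A' DA'] : exists A' : 'M[R]_(1 + n), A' = Q *m A *m Q by eexists.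
have sA' : A'^T = A' by rewrite DA' !trmx_mul sQ sA mulmxA.
have eA' : delta_mx 0 0 *m A' = a *: delta_mx 0 0 :> 'rV[R]_(1 + n).
  by rewrite DA' !mulmxA eQ vA -scalemxAl -eQ -mulmxA QQ mulmx1.
have A'0 j : A' 0 j = a * (j == 0)%:R.
  by have := congr1 (fun M : 'rV[R]_(1 + n) => M 0 j) eA'; rewrite -rowE !mxE eqxx.
pose A1 := drsubmx A'.
have sA1 : A1^T = A1 by rewrite /A1 trmx_drsub sA'.
have [U1 [a1 [oU1 EA1]]] := IH _ sA1.
have EA' : A' = block_mx a%:M 0 0 A1.
  rewrite -[LHS]submxK; congr block_mx.
  - by apply/matrixP => i j; rewrite !ord1 !mxE lshift0 A'0 !eqxx mulr1 mulr1n.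
  - by apply/matrixP => i j; rewrite !ord1 !mxE lshift0 A'0 /= mulr0.
  - apply/matrixP => i j; rewrite !ord1 !mxE lshift0 -sA' mxE A'0 /= mulr0//.
pose B : 'M[R]_(1 + n) := block_mx 1%:M 0 0 U1.
have BB : B *m B^T = 1%:M.
  rewrite /B tr_block_mx !trmx0 trmx1.
  by rewrite mulmx_block !mulmx0 !mul0mx mulmx1 !addr0 add0r oU1 -scalar_mx_block.
have BA : B^T *m diag_mx (row_mx a%:M a1) *m B = A'.
  rewrite diag_mx_row /B tr_block_mx !trmx0 trmx1.
  rewrite !mulmx_block !mulmx0 !mul0mx !mulmx1 !mul1mx !addr0 !add0r.
  have -> : diag_mx (a%:M : 'rV[R]_1) = a%:M.
    by apply/matrixP => i j; rewrite !ord1 !mxE eqxx mulr1n.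
  by rewrite ?mul0mx ?addr0 -EA1 -EA'.
exists (B *m Q), (row_mx a%:M a1); split.
  by rewrite trmx_mul sQ mulmxA -[B *m Q *m Q]mulmxA QQ mulmx1 BB.
rewrite trmx_mul sQ !mulmxA -[Q *m B^T *m _]mulmxA -[Q *m _ *m B]mulmxA BA DA'.
by rewrite !mulmxA QQ mul1mx -mulmxA QQ mulmx1.
Qed.

(** * Functional calculus of symmetric matrices *)

Section FunctionalCalculus.
Variables (R : realType) (n : nat).
Implicit Types (U V W S A X H K L : 'M[R]_n) (a b x : 'rV[R]_n) (f : R -> R).

Definition orth U : Prop := U *m U^T = 1%:M.

Definition smx U a : 'M[R]_n := U^T *m diag_mx a *m U.

Lemma orth_tr U : orth U -> U^T *m U = 1%:M.
Proof. exact: mulmx1C. Qed.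

Lemma orth_mulT U V : orth U -> orth V -> orth (U *m V^T).
Proof.
move=> oU oV; rewrite /orth trmx_mul trmxK mulmxA -[U *m V^T *m V]mulmxA.
by rewrite orth_tr// mulmx1.
Qed.

Lemma smx_sym U a : (smx U a)^T = smx U a.
Proof. by rewrite /smx !trmx_mul trmxK tr_diag_mx mulmxA. Qed.

Lemma smxD U a b : smx U (a + b) = smx U a + smx U b.
Proof. by rewrite /smx linearD /= mulmxDr mulmxDl. Qed.

Lemma smxZ U (t : R) a : smx U (t *: a) = t *: smx U a.
Proof. by rewrite /smx linearZ /= -scalemxAr -scalemxAl. Qed.

Lemma smx1 U : orth U -> smx U (const_mx 1) = 1%:M.
Proof. by move=> oU; rewrite /smx diag_const_mx mulmx1 orth_tr. Qed.

Lemma smxM U a b : orth U -> smx U a *m smx U b = smx U (\row_i (a 0 i * b 0 i)).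
Proof.
move=> oU; rewrite /smx !mulmxA -[_ *m U *m U^T]mulmxA oU mulmx1 -[_ *m diag_mx a *m _]mulmxA.
by rewrite mulmx_diag.
Qed.

Lemma smx_inj U a b : orth U -> smx U a = smx U b -> a = b.
Proof.
move=> oU /(congr1 (fun A => U *m A *m U^T)); rewrite /smx !mulmxA oU !mul1mx.
rewrite -![_ *m U *m U^T]mulmxA oU !mulmx1 => /matrixP E; apply/rowP => i.
by have := E i i; rewrite !mxE eqxx !mulr1n.
Qed.

(** [W = V *m U^T] intertwines the two diagonal matrices, so [W i j] can be nonzero only where
    [a 0 j = b 0 i]. There [f] takes equal values, hence [W] intertwines the images as well. *)
Lemma smx_uniq f U V a b : orth U -> orth V ->
  smx U a = smx V b -> smx U (map_mx f a) = smx V (map_mx f b).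
Proof.
move=> oU oV E; have [W DW] : exists W, W = V *m U^T by eexists.
have EW : W *m diag_mx a = diag_mx b *m W.
  move: E => /(congr1 (fun A => V *m A *m U^T)); rewrite DW /smx !mulmxA oV mul1mx.
  by rewrite -[_ *m U *m U^T]mulmxA oU mulmx1.
have EW' : W *m diag_mx (map_mx f a) = diag_mx (map_mx f b) *m W.
  apply/matrixP => i j; have := congr1 (fun A : 'M[R]_n => A i j) EW.
  rewrite !mul_mx_diag !mul_diag_mx !mxE.
  have [->|w0 h] := eqVneq (W i j) 0; first by rewrite !mul0r !mulr0.
  have -> : a 0 j = b 0 i by apply: (mulfI w0); rewrite h mulrC.
  exact: mulrC.
rewrite /smx.
have -> : U^T = V^T *m W by rewrite DW mulmxA orth_tr// mul1mx.
by rewrite -[V^T *m W *m _]mulmxA EW' DW !mulmxA -[_ *m U^T *m U]mulmxA orth_tr// mulmx1.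
Qed.

(** The choice among diagonalizations is harmless by [smx_uniq]; [(1%:M, 0)] is the default for a
    matrix that has none. *)
Definition mxfun f A : 'M[R]_n :=
  let Ua := xget (1%:M, 0) [set Ua : 'M[R]_n * 'rV[R]_n | orth Ua.1 /\ A = smx Ua.1 Ua.2] in
  smx Ua.1 (map_mx f Ua.2).

Lemma mxfunE f U a : orth U -> mxfun f (smx U a) = smx U (map_mx f a).
Proof.
move=> oU; rewrite /mxfun; case: xgetP => [[V b] _ [/= oV E]|/(_ (U, a))/=].
  exact/esym/smx_uniq.
by move=> h; exfalso; apply: h.
Qed.

Lemma mxtrace_dl S T a : \tr (S^T *m diag_mx a *m T) = \sum_i \sum_j S i j * a 0 i * T i j.
Proof.
rewrite /mxtrace exchange_big /=; apply: eq_bigr => j _.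
by rewrite mxE; apply: eq_bigr => i _; rewrite mul_mx_diag !mxE.
Qed.

Lemma mxtrace_dr S T a : \tr (S *m diag_mx a *m T^T) = \sum_i \sum_j S i j * a 0 j * T i j.
Proof.
rewrite /mxtrace; apply: eq_bigr => j _.
by rewrite mxE; apply: eq_bigr => i _; rewrite mul_mx_diag !mxE.
Qed.

Lemma orth_row W i : orth W -> \sum_j W i j ^+ 2 = 1.
Proof.
move=> /(congr1 (fun A : 'M[R]_n => A i i)); rewrite !mxE eqxx mulr1n => <-.
by apply: eq_bigr => j _; rewrite mxE.
Qed.

Lemma orth_col W j : orth W -> \sum_i W i j ^+ 2 = 1.
Proof.
move=> /orth_tr/(congr1 (fun A : 'M[R]_n => A j j)); rewrite !mxE eqxx mulr1n => <-.
by apply: eq_bigr => i _; rewrite mxE.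
Qed.

(** The squared entries of the orthogonal matrix [U *m V^T] are doubly stochastic weights. As
    [mxtrace_smxl] and [mxtrace_smxr] spread a single trace over the same weights, trace
    inequalities reduce to scalar ones between eigenvalues. *)
Lemma mxtrace_smx2 U V a b :
  \tr (smx U a *m smx V b) = \sum_i \sum_j a 0 i * b 0 j * ((U *m V^T) i j) ^+ 2.
Proof.
have -> : \tr (smx U a *m smx V b) = \tr (diag_mx a *m (U *m V^T) *m diag_mx b *m (U *m V^T)^T).
  by rewrite /smx trmx_mul trmxK -!mulmxA mxtrace_mulC !mulmxA.
rewrite mxtrace_dr; apply: eq_bigr => i _; apply: eq_bigr => j _.
by rewrite mul_diag_mx [in X in X * _ * _]mxE; ring.
Qed.

Lemma mxtrace_smx U a : orth U -> \tr (smx U a) = \sum_i a 0 i.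
Proof.
move=> oU; rewrite /smx -mulmxA mxtrace_mulC -mulmxA oU mulmx1.
by rewrite mxtrace_diag.
Qed.

Lemma mxtrace_smxl U V a : orth U -> orth V ->
  \tr (smx U a) = \sum_i \sum_j a 0 i * ((U *m V^T) i j) ^+ 2.
Proof.
move=> oU oV; rewrite mxtrace_smx//; apply: eq_bigr => i _.
by rewrite -mulr_sumr orth_row ?mulr1//; exact: orth_mulT.
Qed.

Lemma mxtrace_smxr U V b : orth U -> orth V ->
  \tr (smx V b) = \sum_i \sum_j b 0 j * ((U *m V^T) i j) ^+ 2.
Proof.
move=> oU oV; rewrite mxtrace_smx// exchange_big/=; apply: eq_bigr => j _.
by rewrite -mulr_sumr orth_col ?mulr1//; exact: orth_mulT.
Qed.

Definition expm A := mxfun expR A.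

Lemma expm_smx U a : orth U -> expm (smx U a) = smx U (map_mx expR a).
Proof. exact: mxfunE. Qed.

Lemma smxP A : A^T = A -> exists U, exists2 a, orth U & A = smx U a.
Proof. by move=> /spectral_theorem[U [a [oU ->]]]; exists U, a. Qed.

Lemma expm_sym A : A^T = A -> (expm A)^T = expm A.
Proof. by move=> /smxP[U [a oU ->]]; rewrite expm_smx// smx_sym. Qed.

Lemma mxtrace_expm_ge0 A : A^T = A -> 0 <= \tr (expm A).
Proof.
move=> /smxP[U [a oU ->]]; rewrite expm_smx// mxtrace_smx//.
by apply: sumr_ge0 => i _; rewrite mxE expR_ge0.
Qed.

(* Klein's inequality: the convexity of [exp] survives under the trace. *)
Lemma klein K L : K^T = K -> L^T = L ->
  \tr (expm L) + \tr (expm L *m (K - L)) <= \tr (expm K).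
Proof.
move=> /smxP[V [k oV ->]] /smxP[U [l oU ->]]; rewrite !expm_smx//.
rewrite mulmxBr linearB /= mxtrace_smx2 smxM// (mxtrace_smxl _ oU oV).
rewrite (mxtrace_smxl (\row_i _) oU oV) (mxtrace_smxr (map_mx expR k) oU oV).
rewrite -subr_ge0 -!sumrB -big_split -sumrB; apply: sumr_ge0 => i _ /=.
rewrite -!sumrB -big_split -sumrB; apply: sumr_ge0 => j _ /=; rewrite !mxE.
set q := (\sum_(_ < _) _) ^+ 2; have q0 : 0 <= q by exact: sqr_ge0.
have -> : expR (k 0 j) * q - (expR (l 0 i) * q +
   (expR (l 0 i) * k 0 j * q - expR (l 0 i) * l 0 i * q)) =
   q * (expR (k 0 j) - expR (l 0 i) * (1 + (k 0 j - l 0 i))) by ring.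
apply: mulr_ge0 => //; rewrite subr_ge0.
have -> : expR (k 0 j) = expR (l 0 i) * expR (k 0 j - l 0 i).
  by rewrite -expRD addrC subrK.
by rewrite ler_pM2l ?expR_gt0// expR_ge1Dx.
Qed.

Lemma mxtrace_expm_mul_ge0 U a L : orth U -> L^T = L -> (forall i, 0 <= a 0 i) ->
  0 <= \tr (expm L *m smx U a).
Proof.
move=> oU /smxP[V [l oV ->]] a0; rewrite expm_smx// mxtrace_smx2.
apply: sumr_ge0 => i _; apply: sumr_ge0 => j _; rewrite mulr_ge0 ?sqr_ge0//.
by rewrite mulr_ge0// mxE expR_ge0.
Qed.
End FunctionalCalculus.

(** * Integration over the unit interval and the scalar relative entropy *)

Section UnitIntervalIntegral.
Variable R : realType.
Implicit Types (f g : R -> R) (z : R).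

(** Two-sided continuity, at the endpoints too: it is closed under the field operations pointwise
    and yields the one-sided limits that the fundamental theorem of calculus asks for. *)
Definition cont01 f := forall z, 0 <= z <= 1 -> {for z, continuous f}.

Definition int01 f : R := \int[@lebesgue_measure R]_(z in `[0%R, 1%R]) f z.

Lemma cont01_within f : cont01 f -> {within `[0%R, 1%R], continuous f}.
Proof.
move=> cf; apply/continuous_in_subspaceT => z; rewrite inE /= in_itv/=; exact: cf.
Qed.

Lemma cont01_integrable f : cont01 f ->
  (@lebesgue_measure R).-integrable `[0%R, 1%R] (EFin \o f).
Proof.
move=> cf; apply: continuous_compact_integrable; first exact: segment_compact.
exact: cont01_within.
Qed.

Lemma int01D f g : cont01 f -> cont01 g ->
  int01 (fun z => f z + g z) = int01 f + int01 g.
Proof. by move=> cf cg; apply: RintegralD => //; exact: cont01_integrable. Qed.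

Lemma int01Z (t : R) f : cont01 f -> int01 (fun z => t * f z) = t * int01 f.
Proof. by move=> cf; apply: RintegralZl => //; exact: cont01_integrable. Qed.

Lemma int01_le f g : cont01 f -> cont01 g ->
  (forall z, 0 <= z <= 1 -> f z <= g z) -> int01 f <= int01 g.
Proof.
move=> cf cg fg; apply: le_Rintegral => //; try exact: cont01_integrable.
Qed.

Lemma eq_int01 f g : (forall z, 0 <= z <= 1 -> f z = g z) -> int01 f = int01 g.
Proof. by move=> fg; apply: eq_Rintegral => z; rewrite inE/= in_itv/=; exact: fg. Qed.

Lemma cont01_cst (c : R) : cont01 (fun=> c).
Proof. by move=> z _; exact: cst_continuous. Qed.

Lemma cont01_id : cont01 (fun z => z).
Proof. by move=> z _; exact: cvg_id. Qed.

Lemma cont01D f g : cont01 f -> cont01 g -> cont01 (fun z => f z + g z).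
Proof. by move=> cf cg z z01; apply: continuousD; [exact: cf|exact: cg]. Qed.

Lemma cont01B f g : cont01 f -> cont01 g -> cont01 (fun z => f z - g z).
Proof. by move=> cf cg z z01; apply: continuousB; [exact: cf|exact: cg]. Qed.

Lemma cont01N f : cont01 f -> cont01 (fun z => - f z).
Proof. by move=> cf z z01; apply: continuousN; exact: cf. Qed.

Lemma cont01M f g : cont01 f -> cont01 g -> cont01 (fun z => f z * g z).
Proof. by move=> cf cg z z01; apply: continuousM; [exact: cf|exact: cg]. Qed.

Lemma cont01V f : cont01 f -> (forall z, 0 <= z <= 1 -> f z != 0) ->
  cont01 (fun z => (f z)^-1).
Proof. by move=> cf f0 z z01; apply: continuousV; [exact: f0|exact: cf]. Qed.

Lemma cont01_sum (I : Type) (r : seq I) (F : I -> R -> R) :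
  (forall i, cont01 (F i)) -> cont01 (fun z => \sum_(i <- r) F i z).
Proof.
move=> cF; elim: r => [|i r IH].
  by under eq_fun do rewrite big_nil; exact: cont01_cst.
by under eq_fun do rewrite big_cons; exact: cont01D.
Qed.

Lemma int01_sum (I : Type) (r : seq I) (F : I -> R -> R) :
  (forall i, cont01 (F i)) ->
  int01 (fun z => \sum_(i <- r) F i z) = \sum_(i <- r) int01 (F i).
Proof.
move=> cF; elim: r => [|i r IH].
  under [in LHS]eq_int01 do rewrite big_nil.
  by rewrite big_nil /int01 Rintegral_cst// mul0r.
under [in LHS]eq_int01 do rewrite big_cons.
by rewrite int01D ?IH ?big_cons//; exact: cont01_sum.
Qed.

Lemma chord_gt0 (a x z : R) : 0 < a -> 0 < x -> 0 <= z <= 1 -> 0 < (1 - z) * a + z * x.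
Proof. by move=> a0 x0 /andP[z0 z1]; nra. Qed.

Lemma cont01_chord (a x : R) : cont01 (fun z => (1 - z) * a + z * x).
Proof.
apply: cont01D; apply: cont01M; try exact: cont01_cst; last exact: cont01_id.
by apply: cont01B; [exact: cont01_cst|exact: cont01_id].
Qed.

Lemma cont01_chordV (a x : R) : 0 < a -> 0 < x ->
  cont01 (fun z => ((1 - z) * a + z * x)^-1).
Proof.
move=> a0 x0; apply: cont01V; first exact: cont01_chord.
by move=> z z01; rewrite gt_eqF// chord_gt0.
Qed.

(* The integral representation of the relative entropy [x ln (x/a) - x + a] as an
   average of quadratic-over-linear functions, which are jointly convex. *)
Lemma relative_entropy_int01 (a x : R) : 0 < a -> 0 < x ->
  int01 (fun z => (1 - z) * ((a - x) ^+ 2 / ((1 - z) * a + z * x)))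
    = x * (ln x - ln a) - x + a.
Proof.
move=> a0 x0; pose F : R -> R := fun z => x * ln ((1 - z) * a + z * x) - (x - a) * z.
pose f : R -> R := fun z => (1 - z) * ((a - x) ^+ 2 / ((1 - z) * a + z * x)).
have dF z : 0 <= z <= 1 -> is_derive z 1 F (f z).
  move=> z01; have g0 := chord_gt0 a0 x0 z01.
  pose g : R -> R := fun z => (1 - z) * a + z * x.
  have dg : is_derive z 1 g (x - a).
    have -> : g = cst a + (x - a) \*: id.
      by apply/funext => y; change ((1 - y) * a + y * x = a + (x - a) * y); ring.
    apply: is_derive_eq.
    by rewrite add0r scaler1.
  have dl : is_derive z 1 (@ln R \o g) ((g z)^-1 * (x - a)).
    by apply: is_derive1_comp; exact: is_derive1_ln.
  have -> : F = x \*: (@ln R \o g) - (x - a) \*: id by [].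
  apply: is_derive_eq; rewrite /f -/(g z) /= /GRing.scale /= mulr1.
  have : g z != 0 by rewrite gt_eqF.
  by rewrite /g => ?; field.
have cF : cont01 F.
  move=> z /dF df; apply: differentiable_continuous; apply/derivable1_diffP.
  by apply: ex_derive.
have cf : cont01 f.
  apply: cont01M; first by apply: cont01B; [exact: cont01_cst|exact: cont01_id].
  by apply: cont01M; [exact: cont01_cst|exact: cont01_chordV].
have E : (\int[@lebesgue_measure R]_(z in `[0%R, 1%R]) (f z)%:E = (F 1)%:E - (F 0)%:E)%E.
  apply: continuous_FTC2 => //; first exact: cont01_within.
    split.
    - move=> z; rewrite in_itv/= => /andP[z0 z1].
      by apply: ex_derive; apply: dF; rewrite !ltW.
    - by apply: cvg_at_right_filter; apply: cF; rewrite lexx ler01.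
    - by apply: cvg_at_left_filter; apply: cF; rewrite lexx ler01.
  move=> z; rewrite in_itv/= => /andP[z0 z1].
  have z01 : 0 <= z <= 1 by rewrite !ltW.
  by rewrite derive1E (derive_val (is_derive := dF z z01)).
rewrite /int01 /Rintegral E /= /F subrr subr0 !mul0r !mul1r add0r addr0 mulr0 mulr1 subr0.
ring.
Qed.
End UnitIntervalIntegral.

(** * Matrix relative entropy as an integral of maxima of linear functions *)

Section Lieb.
Variables (R : realType) (n : nat).
Implicit Types (U V W S A X H K L Y : 'M[R]_n) (a b x k l : 'rV[R]_n) (z t : R).

(** The relative entropy $tr X (log X - log A) - tr X + tr A$ at $X = exp K$ and $A = exp L$. *)
Definition relent K L : R := \tr (expm K *m (K - L)) - \tr (expm K) + \tr (expm L).

Lemma relentE U V k l : orth U -> orth V ->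
  relent (smx V k) (smx U l) = \sum_i \sum_j ((U *m V^T) i j) ^+ 2 *
    (expR (k 0 j) * (k 0 j - l 0 i) - expR (k 0 j) + expR (l 0 i)).
Proof.
move=> oU oV; rewrite /relent !expm_smx// mulmxBr linearB /= smxM//.
rewrite [\tr (_ *m _)]mxtrace_mulC mxtrace_smx2 !(mxtrace_smxr _ oU oV) (mxtrace_smxl _ oU oV).
rewrite -!sumrB -big_split; apply: eq_bigr => i _ /=.
rewrite -!sumrB -big_split; apply: eq_bigr => j _ /=; rewrite ![in LHS]mxE.
by rewrite ![in RHS]mxE; ring.
Qed.

(** With $A$ = [smx U a] and $X$ = [smx V x], this is $1 - z$ times the quadratic form at $A - X$ of
    the inverse of the operator $W \mapsto (1-z) A W + z W X$. That operator is diagonal in the two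
    eigenbases, with eigenvalues $(1-z) a_i + z x_j$. *)
Definition quad_over_lin U V a x z : R := \sum_i \sum_j ((U *m V^T) i j) ^+ 2 *
  ((1 - z) * ((a 0 i - x 0 j) ^+ 2 / ((1 - z) * a 0 i + z * x 0 j))).

(** The dual form of the quadratic, from $y^2 / g = \max_w (2 w y - g w^2)$ for $g > 0$. For fixed
    [W] it is linear in the pair [(X, A)], and no eigenbasis occurs in it. *)
Definition linear_minorant z W X A : R :=
  (1 - z) * (2 * \tr (W^T *m (A - X)) - (1 - z) * \tr (W^T *m A *m W)
             - z * \tr (W *m X *m W^T)).

Lemma linear_minorant_basis U V a x z W : orth U -> orth V ->
  linear_minorant z W (smx V x) (smx U a) =
  \sum_i \sum_j (1 - z) * (2 * (U *m W *m V^T) i j * ((U *m V^T) i j * (a 0 i - x 0 j))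
     - ((1 - z) * a 0 i + z * x 0 j) * ((U *m W *m V^T) i j) ^+ 2).
Proof.
move=> oU oV; 
have [T DT] : exists T, T = U *m W *m V^T by eexists.
have [C DC] : exists C, C = U *m V^T by eexists.
rewrite -DT -DC; have WE : W = U^T *m T *m V.
  by rewrite DT !mulmxA orth_tr// mul1mx -mulmxA orth_tr// mulmx1.
have E1 : \tr (W^T *m smx U a) = \sum_i \sum_j T i j * a 0 i * C i j.
  rewrite -mxtrace_dl /smx WE !trmx_mul trmxK DC !mulmxA.
  rewrite -[_ *m U *m U^T]mulmxA oU mulmx1.
  by rewrite [RHS]mxtrace_mulC !mulmxA.
have E2 : \tr (W^T *m smx V x) = \sum_i \sum_j C i j * x 0 j * T i j.
  rewrite -mxtrace_dr /smx WE !trmx_mul trmxK DC.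
  rewrite [RHS]mxtrace_mulC !mulmxA [LHS]mxtrace_mulC !mulmxA oV mul1mx.
  by [].
have E3 : \tr (W^T *m smx U a *m W) = \sum_i \sum_j T i j * a 0 i * T i j.
  rewrite -mxtrace_dl /smx [in LHS]WE !trmx_mul trmxK !mulmxA.
  rewrite -[_ *m U *m U^T]mulmxA oU mulmx1 -[_ *m U *m U^T]mulmxA oU mulmx1.
  by rewrite mxtrace_mulC !mulmxA oV mul1mx.
have E4 : \tr (W *m smx V x *m W^T) = \sum_i \sum_j T i j * x 0 j * T i j.
  rewrite -mxtrace_dr /smx [in LHS]WE !trmx_mul trmxK !mulmxA.
  rewrite -[_ *m V *m V^T]mulmxA oV mulmx1 -[_ *m V *m V^T]mulmxA oV mulmx1.
  by rewrite mxtrace_mulC !mulmxA oU mul1mx.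
rewrite /linear_minorant mulmxBr linearB /= E1 E2 E3 E4.
rewrite !pair_bigA /= -sumrB !mulr_sumr -!sumrB mulr_sumr; apply: eq_bigr => -[i j] _ /=.
ring.
Qed.

Lemma linear_minorant_le U V a x z W : orth U -> orth V -> 0 <= z <= 1 ->
  (forall i, 0 < a 0 i) -> (forall i, 0 < x 0 i) ->
  linear_minorant z W (smx V x) (smx U a) <= quad_over_lin U V a x z.
Proof.
move=> oU oV z01 a0 x0; rewrite linear_minorant_basis//.
apply: ler_sum => i _; apply: ler_sum => j _.
have g0 := chord_gt0 (a0 i) (x0 j) z01.
move: ((1 - z) * a 0 i + z * x 0 j) g0 => g g0.
move: ((U *m W *m V^T) i j) ((U *m V^T) i j) => T C.
rewrite [leRHS]mulrCA; apply: ler_wpM2l; first by rewrite subr_ge0; case/andP: z01.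
rewrite -subr_ge0; have -> : C ^+ 2 * ((a 0 i - x 0 j) ^+ 2 / g) -
  (2 * T * (C * (a 0 i - x 0 j)) - g * T ^+ 2) =
  (C * (a 0 i - x 0 j) - g * T) ^+ 2 / g by field; rewrite gt_eqF.
by rewrite divr_ge0 ?sqr_ge0// ltW.
Qed.

(** The maximiser $w = y / g$ in each entry of the eigenbases, carried back to the standard
    basis. *)
Definition optimal_W U V a x z : 'M[R]_n :=
  U^T *m (\matrix_(i, j) ((a 0 i - x 0 j) * ((1 - z) * a 0 i + z * x 0 j)^-1 *
            (U *m V^T) i j)) *m V.

Lemma linear_minorant_eq U V a x z : orth U -> orth V -> 0 <= z <= 1 ->
  (forall i, 0 < a 0 i) -> (forall i, 0 < x 0 i) ->
  linear_minorant z (optimal_W U V a x z) (smx V x) (smx U a) = quad_over_lin U V a x z.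
Proof.
move=> oU oV z01 a0 x0; rewrite linear_minorant_basis//.
have -> : U *m optimal_W U V a x z *m V^T = \matrix_(i, j) ((a 0 i - x 0 j) *
    ((1 - z) * a 0 i + z * x 0 j)^-1 * (U *m V^T) i j).
  by rewrite /optimal_W !mulmxA oU mul1mx -mulmxA oV mulmx1.
apply: eq_bigr => i _; apply: eq_bigr => j _.
have g0 := chord_gt0 (a0 i) (x0 j) z01; rewrite [in LHS]mxE.
move: ((U *m V^T) i j) => C.
move: ((1 - z) * a 0 i + z * x 0 j) g0 => g g0.
by field; rewrite gt_eqF.
Qed.

Lemma relent_int01 U V k l : orth U -> orth V ->
  relent (smx V k) (smx U l) =
  int01 (quad_over_lin U V (map_mx expR l) (map_mx expR k)) /\
  cont01 (quad_over_lin U V (map_mx expR l) (map_mx expR k)).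
Proof.
move=> oU oV; rewrite relentE//.
have c i j : cont01 (fun z => (1 - z) * ((expR (l 0 i) - expR (k 0 j)) ^+ 2 /
       ((1 - z) * expR (l 0 i) + z * expR (k 0 j)))).
  apply: cont01M; first by apply: cont01B; [exact: cont01_cst|exact: cont01_id].
  by apply: cont01M; [exact: cont01_cst|apply: cont01_chordV; exact: expR_gt0].
have -> : quad_over_lin U V (map_mx expR l) (map_mx expR k) = fun z =>
   \sum_i \sum_j ((U *m V^T) i j) ^+ 2 * ((1 - z) * ((expR (l 0 i) - expR (k 0 j)) ^+ 2 /
       ((1 - z) * expR (l 0 i) + z * expR (k 0 j)))).
  apply/funext => z; rewrite /quad_over_lin; apply: eq_bigr => i _; apply: eq_bigr => j _.
  by congr (_ * _); rewrite !mxE.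
have c' i j : cont01 (fun z => ((U *m V^T) i j) ^+ 2 * ((1 - z) * ((expR (l 0 i) - expR (k 0 j)) ^+ 2 /
       ((1 - z) * expR (l 0 i) + z * expR (k 0 j))))).
  by apply: cont01M; [exact: cont01_cst|exact: c].
have c'' i := @cont01_sum R 'I_n (index_enum _) _ (c' i).
split; last exact: cont01_sum.
rewrite int01_sum//; apply: eq_bigr => i _; rewrite int01_sum//; apply: eq_bigr => j _.
rewrite int01Z; last exact: c.
by rewrite relative_entropy_int01 ?expR_gt0// !expRK.
Qed.

Lemma mxtrace_int01 (B : R -> 'M[R]_n) A : (forall p q, cont01 (fun z => B z p q)) ->
  cont01 (fun z => \tr (B z *m A)) /\
  int01 (fun z => \tr (B z *m A)) = \tr ((\matrix_(p, q) int01 (fun z => B z p q)) *m A).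
Proof.
move=> cB.
have E : (fun z => \tr (B z *m A)) = fun z => \sum_p \sum_q A q p * B z p q.
  apply/funext => z; apply: eq_bigr => p _; rewrite mxE; apply: eq_bigr => q _.
  exact: mulrC.
have c p q : cont01 (fun z => A q p * B z p q).
  by apply: cont01M; [exact: cont01_cst|exact: cB].
have c' p := @cont01_sum R 'I_n (index_enum _) _ (c p).
rewrite E; split; first exact: cont01_sum.
rewrite int01_sum//; apply: eq_bigr => p _; rewrite int01_sum// mxE; apply: eq_bigr => q _.
by rewrite int01Z ?mxE; [exact: mulrC|exact: cB].
Qed.
End Lieb.

(** * Lieb's concavity theorem *)

Section LiebConcavity.
Variables (R : realType) (n : nat).
Implicit Types (U V W S A X H K L Y : 'M[R]_n) (a b x k l : 'rV[R]_n) (z t : R).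

Lemma cont01_optimal_W U V a x p q :
  (forall i, 0 < a 0 i) -> (forall i, 0 < x 0 i) ->
  cont01 (fun z => optimal_W U V a x z p q).
Proof.
move=> a0 x0; under eq_fun do rewrite mxE.
apply: cont01_sum => j; apply: cont01M; last exact: cont01_cst.
under eq_fun do rewrite mxE.
apply: cont01_sum => i; apply: cont01M; first exact: cont01_cst.
under eq_fun do rewrite mxE.
apply: cont01M; last exact: cont01_cst.
by apply: cont01M; [exact: cont01_cst|exact: cont01_chordV].
Qed.

(* Joint convexity of the relative entropy, as a supporting hyperplane. *)
Lemma relent_support K0 L0 : K0^T = K0 -> L0^T = L0 ->
  exists M N, (forall K L, K^T = K -> L^T = L ->
      \tr (M *m expm L) + \tr (N *m expm K) <= relent K L) /\
    \tr (M *m expm L0) + \tr (N *m expm K0) = relent K0 L0.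
Proof.
move=> /smxP[V0 [k0 oV0 ->]] /smxP[U0 [l0 oU0 ->]].
pose a0 := map_mx expR l0; pose x0 := map_mx expR k0.
have ap i : 0 < a0 0 i by rewrite mxE expR_gt0.
have xp i : 0 < x0 0 i by rewrite mxE expR_gt0.
(* The maximiser of the base point is kept for all other points: the minorant stays below the
   entropy everywhere, is linear, and touches it at the base point. *)
pose W := optimal_W U0 V0 a0 x0.
have cW p q : cont01 (fun z => W z p q) by exact: cont01_optimal_W.
have c1z : cont01 (fun z : R => 1 - z).
  by apply: cont01B; [exact: cont01_cst|exact: cont01_id].
pose Mz z : 'M[R]_n := (1 - z) *: (2 *: (W z)^T - (1 - z) *: (W z *m (W z)^T)).
pose Nz z : 'M[R]_n := - (1 - z) *: (2 *: (W z)^T + z *: ((W z)^T *m W z)).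
have cM p q : cont01 (fun z => Mz z p q).
  have -> : (fun z => Mz z p q) = fun z =>
      (1 - z) * (2 * W z q p - (1 - z) * \sum_j W z p j * W z q j).
    apply/funext => z; rewrite /Mz; move: (W z) => w; rewrite !mxE.
    by congr (_ * (_ - _ * _)); apply: eq_bigr => j _; rewrite mxE.
  apply: cont01M => //; apply: cont01B; first by apply: cont01M; [exact: cont01_cst|].
  by apply: cont01M => //; apply: cont01_sum => j; exact: cont01M.
have cN p q : cont01 (fun z => Nz z p q).
  have -> : (fun z => Nz z p q) = fun z =>
      - (1 - z) * (2 * W z q p + z * \sum_j W z j p * W z j q).
    apply/funext => z; rewrite /Nz; move: (W z) => w; rewrite !mxE.
    by congr (_ * (_ + _ * _)); apply: eq_bigr => j _; rewrite mxE.
  apply: cont01M; first exact: cont01N.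
  apply: cont01D; first by apply: cont01M; [exact: cont01_cst|].
  by apply: cont01M; [exact: cont01_id|]; apply: cont01_sum => j; exact: cont01M.
have E z X A : linear_minorant z (W z) X A = \tr (Mz z *m A) + \tr (Nz z *m X).
  rewrite /linear_minorant /Mz /Nz; move: (W z) => w.
  have trB (B C : 'M[R]_n) : \tr (B - C) = \tr B - \tr C by rewrite raddfB.
  rewrite -!scalemxAl !mxtraceZ mulmxBl mulmxDl mulmxBr !trB mxtraceD -!scalemxAl !mxtraceZ.
  rewrite [\tr (w^T *m A *m w)]mxtrace_mulC [\tr (w *m X *m w^T)]mxtrace_mulC !mulmxA.
  ring.
exists (\matrix_(p, q) int01 (fun z => Mz z p q)), (\matrix_(p, q) int01 (fun z => Nz z p q)).
have EI X A : cont01 (fun z => linear_minorant z (W z) X A) /\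
    int01 (fun z => linear_minorant z (W z) X A) =
    \tr ((\matrix_(p, q) int01 (fun z => Mz z p q)) *m A) +
    \tr ((\matrix_(p, q) int01 (fun z => Nz z p q)) *m X).
  have [c1 <-] := mxtrace_int01 A cM; have [c2 <-] := mxtrace_int01 X cN.
  under eq_fun do rewrite E.
  by split; [exact: cont01D|rewrite int01D].
split.
  move=> K L /smxP[V [k oV ->]] /smxP[U [l oU ->]].
  have [-> c] := relent_int01 k l oU oV; have [c' <-] := EI (expm (smx V k)) (expm (smx U l)).
  apply: int01_le => // z z01; rewrite !expm_smx//.
  by apply: linear_minorant_le => // i; rewrite mxE expR_gt0.
have [-> c] := relent_int01 k0 l0 oU0 oV0.
have [c' <-] := EI (expm (smx V0 k0)) (expm (smx U0 l0)).
by apply: eq_int01 => z z01; rewrite !expm_smx//; exact: linear_minorant_eq.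
Qed.

(** The entropy vanishes to second order at [K0]: for scalars, $x \ln (x/a) - x + a \le (x - a)^2 /
    a$ because $\ln y \le y - 1$. *)
Lemma relent_le_sqr K0 : K0^T = K0 -> exists2 C, 0 <= C & forall K, K^T = K ->
  relent K K0 <= C * \tr ((expm K - expm K0) *m (expm K - expm K0)).
Proof.
move=> /smxP[U [l oU ->]]; exists (\sum_i (expR (l 0 i))^-1).
  by apply: sumr_ge0 => i _; rewrite invr_ge0 expR_ge0.
move=> K /smxP[V [k oV ->]]; rewrite relentE// !expm_smx//.
have -> : \tr ((smx V (map_mx expR k) - smx U (map_mx expR l)) *m
               (smx V (map_mx expR k) - smx U (map_mx expR l))) =
  \sum_i \sum_j ((U *m V^T) i j) ^+ 2 * (expR (k 0 j) - expR (l 0 i)) ^+ 2.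
  have trB (B C : 'M[R]_n) : \tr (B - C) = \tr B - \tr C by rewrite raddfB.
  rewrite mulmxBl !mulmxBr !trB !smxM// [\tr (smx V _ *m smx U _)]mxtrace_mulC mxtrace_smx2.
  rewrite (mxtrace_smxl _ oU oV) (mxtrace_smxr _ oU oV).
  rewrite !pair_bigA /= -!sumrB; apply: eq_bigr => -[i j] _ /=.
  by move: ((U *m V^T) i j) => c; rewrite !mxE; ring.
rewrite mulr_sumr; apply: ler_sum => i _; rewrite mulr_sumr; apply: ler_sum => j _.
rewrite mulrCA; apply: ler_wpM2l; first exact: sqr_ge0.
have a0 := expR_gt0 (l 0 i); set a := expR (l 0 i); set x := expR (k 0 j).
have xa : k 0 j - l 0 i <= x / a - 1.
  have := expR_ge1Dx (k 0 j - l 0 i); rewrite expRD expRN -/a -/x; lra.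
apply: (@le_trans _ _ (a^-1 * (x - a) ^+ 2)); last first.
  apply: ler_wpM2r; first exact: sqr_ge0.
  rewrite (bigD1 i)//= lerDl; apply: sumr_ge0 => m _; rewrite invr_ge0 expR_ge0//.
have -> : a^-1 * (x - a) ^+ 2 = x * (x / a - 1) - x + a by field; rewrite gt_eqF.
by rewrite lerD2r lerB// ler_wpM2l// expR_ge0.
Qed.

Lemma expm_onto S : S^T = S -> (forall v : 'rV[R]_n, v != 0 -> 0 < (v *m S *m v^T) 0 0) ->
  exists2 K, K^T = K & expm K = S.
Proof.
move=> /smxP[U [s oU ->]] pS; exists (smx U (map_mx (@ln R) s)); first exact: smx_sym.
rewrite expm_smx//; congr smx; apply/rowP => i; rewrite !mxE lnK// posrE.
have r0 : row i U != 0.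
  apply/eqP => r0; have := orth_row i oU; rewrite big1 => [/eqP|j _].
    by rewrite eq_sym oner_eq0.
  by have /rowP/(_ j) := r0; rewrite !mxE => ->; rewrite expr0n.
suff E : row i U *m smx U s *m (row i U)^T = (s 0 i)%:M.
  by have := pS _ r0; rewrite E mxE eqxx mulr1n.
rewrite rowE trmx_mul !mulmxA -[delta_mx 0 i *m U *m _]mulmxA /smx !mulmxA.
rewrite -[delta_mx 0 i *m U *m U^T]mulmxA oU mulmx1 -[_ *m U *m U^T]mulmxA oU mulmx1 -rowE.
by rewrite row_diag_mx -scalemxAl trmx_delta mul_delta_mx [delta_mx 0 0]mx11_scalar mxE !eqxx
  scale_scalar_mx mulr1.
Qed.

Lemma row_sqnorm_orth U (v : 'rV[R]_n) : orth U ->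
  \sum_i (v *m U^T) 0 i ^+ 2 = \sum_i v 0 i ^+ 2.
Proof.
move=> oU; rewrite -!row_sqnormE trmx_mul trmxK mulmxA -[v *m U^T *m U]mulmxA.
by rewrite orth_tr// mulmx1.
Qed.

Lemma smx_qform U a (v : 'rV[R]_n) :
  (v *m smx U a *m v^T) 0 0 = \sum_i a 0 i * (v *m U^T) 0 i ^+ 2.
Proof.
have -> : v *m smx U a *m v^T = (v *m U^T) *m diag_mx a *m (v *m U^T)^T.
  by rewrite /smx trmx_mul trmxK !mulmxA.
move: (v *m U^T) => w; rewrite mxE; apply: eq_bigr => i _.
by rewrite mul_mx_diag !mxE; ring.
Qed.

Lemma expm_perturb K0 K1 : K0^T = K0 -> K1^T = K1 -> exists2 e, 0 < e &
  forall t, `|t| <= e -> exists2 K, K^T = K & expm K = expm K0 + t *: expm K1.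
Proof.
move=> sK0 sK1; move: (sK0) (sK1) => /smxP[U [k oU EK0]] /smxP[V [l oV EK1]].
(* [C^-1] bounds the eigenvalues of [expm K0] from below and [D - 1] those of [expm K1] from above;
   the spare 1 in [D] makes the perturbed form strictly positive. *)
pose C := 1 + \sum_i expR (- k 0 i); pose D := 1 + \sum_i expR (l 0 i).
have C0 : 0 < C by rewrite ltr_pwDl ?ltr01// sumr_ge0// => i _; exact: expR_ge0.
have D0 : 0 < D by rewrite ltr_pwDl ?ltr01// sumr_ge0// => i _; exact: expR_ge0.
exists (C * D)^-1; first by rewrite invr_gt0 mulr_gt0.
move=> t te; apply: expm_onto.
  by rewrite linearD linearZ /= !expm_sym.
move=> v v0; rewrite mulmxDr mulmxDl -scalemxAr -scalemxAl mxE [X in _ + X]mxE.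
rewrite EK0 EK1 !expm_smx// !smx_qform; set w := v *m U^T; set y := v *m V^T.
have N0 : 0 < \sum_i v 0 i ^+ 2.
  rewrite -row_sqnormE lt_def row_sqnormE sumr_ge0 ?andbT => [|i _]; last exact: sqr_ge0.
  by rewrite -row_sqnormE; apply: contra v0 => /eqP/row_sqnorm_eq0 ->.
have kC i : C^-1 <= expR (k 0 i).
  rewrite -[leRHS]invrK lef_pV2 ?posrE ?invr_gt0 ?expR_gt0// -expRN /C (bigD1 i)//= addrCA.
  by rewrite lerDl addr_ge0// sumr_ge0// => j _; exact: expR_ge0.
have lD i : expR (l 0 i) <= D - 1.
  by rewrite /D addrC addKr (bigD1 i)//= lerDl sumr_ge0// => j _; exact: expR_ge0.
have h1 : C^-1 * \sum_i v 0 i ^+ 2 <= \sum_i map_mx expR k 0 i * w 0 i ^+ 2.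
  rewrite -(row_sqnorm_orth v oU) mulr_sumr; apply: ler_sum => i _.
  by apply: ler_wpM2r; [exact: sqr_ge0|rewrite mxE].
have h2 : \sum_i map_mx expR l 0 i * y 0 i ^+ 2 <= (D - 1) * \sum_i v 0 i ^+ 2.
  rewrite -(row_sqnorm_orth v oV) mulr_sumr; apply: ler_sum => i _.
  by apply: ler_wpM2r; [exact: sqr_ge0|rewrite mxE].
have h3 : 0 <= \sum_i map_mx expR l 0 i * y 0 i ^+ 2.
  by apply: sumr_ge0 => i _; rewrite mulr_ge0 ?sqr_ge0// mxE expR_ge0.
move: (\sum_i v 0 i ^+ 2) N0 h1 h2 => N N0 h1 h2.
apply: (@lt_le_trans _ _ (C^-1 * N - (C * D)^-1 * ((D - 1) * N))).
  have -> : C^-1 * N - (C * D)^-1 * ((D - 1) * N) = (C * D)^-1 * N.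
    by field; rewrite !gt_eqF.
  by rewrite mulr_gt0// invr_gt0 mulr_gt0.
apply: lerD => //; rewrite lerNl; apply: (@le_trans _ _ (`|t| *
   \sum_i map_mx expR l 0 i * y 0 i ^+ 2)).
  by rewrite -mulNr; apply: ler_wpM2r => //; rewrite -normrN ler_norm.
by apply: ler_pM.
Qed.

(** The first-order condition at an extremum, for a function known only up to a quadratic error. It
    stands in for a derivative in [lieb] and for the normal equations. *)
Lemma quadratic_perturbation (p C e : R) : 0 < e -> 0 <= C ->
  (forall t, `|t| <= e -> 0 <= t * p + C * t ^+ 2) -> p = 0.
Proof.
move=> e0 C0 h; apply/eqP/negPn/negP => p0.
(* Small enough that [t = - s * p] satisfies both [|t| <= e] and [C * s < 1]; then the expression is
   [s * p ^+ 2 * (C * s - 1) < 0]. *)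
pose s := (1 + C + `|p| / e)^-1.
have q0 : 0 <= `|p| / e by rewrite divr_ge0// ltW.
have s0 : 0 < s by rewrite invr_gt0; lra.
have le_e : `|- s * p| <= e.
  rewrite normrM normrN (gtr0_norm s0) mulrC /s ler_pdivrMr; last lra.
  have E : e * (`|p| / e) = `|p| by field; rewrite gt_eqF.
  by rewrite mulrDr E lerDr mulr_ge0//; lra.
have := h _ le_e; have -> : - s * p * p + C * (- s * p) ^+ 2 = (s * p ^+ 2) * (C * s - 1) by ring.
apply/negP; rewrite -ltNge pmulr_rlt0; last by rewrite mulr_gt0// exprn_even_gt0.
by rewrite subr_lt0 /s ltr_pdivrMr; lra.
Qed.

(* Concavity of [A |-> tr exp (H + log A)], as a supporting hyperplane at [A = exp L0].
   [N] is the coefficient of [exp K] in the hyperplane supporting the relative entropy; it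
   vanishes because [K = H + L0] is the maximiser in the Gibbs variational formula. *)
Theorem lieb H L0 : H^T = H -> L0^T = L0 -> exists M,
  (forall L, L^T = L -> \tr (expm (H + L)) <= \tr (M *m expm L)) /\
  \tr (M *m expm L0) = \tr (expm (H + L0)).
Proof.
move=> sH sL0; pose K0 := H + L0.
have sD L : L^T = L -> (H + L)^T = H + L by move=> sL; rewrite linearD /= sH sL.
have sK0 : K0^T = K0 by exact: sD.
have trB (B C : 'M[R]_n) : \tr (B - C) = \tr B - \tr C by rewrite raddfB.
have [M1 [N1 [hle heq]]] := relent_support sK0 sL0.
pose M := 1%:M - M1; pose N := H - N1.
have up K L : K^T = K -> L^T = L ->
    \tr (H *m expm K) + \tr (expm L) - relent K L <= \tr (M *m expm L) + \tr (N *m expm K).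
  move=> sK sL; rewrite /M /N !mulmxBl !trB mul1mx.
  have := hle _ _ sK sL; lra.
have up0 : \tr (H *m expm K0) + \tr (expm L0) - relent K0 L0 =
    \tr (M *m expm L0) + \tr (N *m expm K0).
  by rewrite /M /N !mulmxBl !trB mul1mx -heq; ring.
have g0 K : \tr (H *m expm K) + \tr (expm L0) - relent K L0 = \tr (expm K0) - relent K K0.
  have -> : relent K K0 = \tr (expm K *m (K - L0 - H)) - \tr (expm K) + \tr (expm K0).
    by rewrite /relent /K0 opprD addrA [K - H - _]addrAC.
  by rewrite /relent [\tr (H *m _)]mxtrace_mulC !mulmxBr !trB; ring.
have gL L : \tr (H *m expm (H + L)) + \tr (expm L) - relent (H + L) L = \tr (expm (H + L)).
  by rewrite /relent addrK [\tr (H *m _)]mxtrace_mulC; ring.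
(* Moving [expm K0] by [t *: expm K] lowers the Gibbs functional by only [O(t^2)], while the
   hyperplane above it moves linearly in [t]. As both signs of [t] are allowed, the slope is
   zero. *)
have N0 K : K^T = K -> \tr (N *m expm K) = 0.
  move=> sK; have [e e0 he] := expm_perturb sK0 sK.
  have [C C0 hC] := relent_le_sqr sK0.
  pose Q := \tr (expm K *m expm K).
  apply: (@quadratic_perturbation _ (C * `|Q|) e) => //; first by rewrite mulr_ge0.
  move=> t /he[K' sK' EK']; have := up _ _ sK' sL0; rewrite g0.
  have := up0; rewrite gL => up0'.
  have := hC _ sK'; rewrite EK' [_ + _ - _]addrC addKr -scalemxAl -scalemxAr !mxtraceZ -/Q.
  rewrite mulmxDr mxtraceD -scalemxAr mxtraceZ.
  have : C * (t * (t * Q)) <= C * `|Q| * t ^+ 2.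
    have -> : C * (t * (t * Q)) = C * Q * t ^+ 2 by ring.
    by rewrite ler_wpM2r ?sqr_ge0// ler_wpM2l// ler_norm.
  move: up0'; rewrite -/K0; lra.
exists M; split.
  by move=> L sL; rewrite -[leLHS]gL; have := up _ _ (sD _ sL) sL; rewrite [\tr (N *m _)]N0 ?addr0//; exact: sD.
by have := up0; rewrite gL N0// addr0.
Qed.
End LiebConcavity.

(** Holds for arbitrary nonnegative functions, since the integral is a supremum over the simple
    functions below. This is what bounds the risk when the estimator is not known to be
    measurable. *)
Lemma ge0_le_integralW (d : measure_display) (T : measurableType d) (R : realType)
  (mu : {measure set T -> \bar R}) (f g : T -> \bar R) :
  (forall x, 0 <= f x)%E -> (forall x, f x <= g x)%E ->
  (\int[mu]_x f x <= \int[mu]_x g x)%E.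
Proof.
move=> f0 fg; have g0 x : (0 <= g x)%E by exact: le_trans (f0 x) (fg x).
rewrite !ge0_integralTE//; apply: ge_ereal_sup => _ [h hf <-].
by apply: ereal_sup_ubound; exists h => // x; exact: le_trans (hf x) (fg x).
Qed.

(** * Measurability of the trace exponential *)

Section MeasurableTraceExp.
Context (R : realType) (n : nat).

Lemma iter_mulmx_smx (U : 'M[R]_n) (a : 'rV[R]_n) k : orth U ->
  iter k (mulmx (smx U a)) 1%:M = smx U (\row_i (a 0 i ^+ k)).
Proof.
move=> oU; elim: k => [|k IH] /=.
  by rewrite -(smx1 oU); congr smx; apply/rowP => i; rewrite !mxE expr0.
rewrite IH smxM//; congr smx; apply/rowP => i; rewrite !mxE exprS//.
Qed.

(** [mxfun] rests on a choice of eigenbasis, which says nothing about measurability; the power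
    series shows the trace to be a limit of polynomials in the entries. *)
Lemma mxtrace_expm_cvg (A : 'M[R]_n) : A^T = A ->
  (fun N => \sum_(0 <= k < N) \tr (iter k (mulmx A) 1%:M) / k`!%:R) @ \oo --> \tr (expm A).
Proof.
move=> /smxP[U [a oU ->]]; rewrite expm_smx// mxtrace_smx//.
have -> : (fun N => \sum_(0 <= k < N) \tr (iter k (mulmx (smx U a)) 1%:M) / k`!%:R) =
   (fun N => \sum_i series (exp_coeff (a 0 i)) N).
  apply/funext => N; rewrite exchange_big /=; apply: eq_bigr => k _.
  rewrite iter_mulmx_smx// mxtrace_smx// mulr_suml; apply: eq_bigr => i _.
  by rewrite mxE.
apply: cvg_big => //; first exact: add_continuous.
by move=> i _; rewrite mxE; exact: is_cvg_series_exp_coeff.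
Qed.

Context (d : measure_display) (T : measurableType d).

Definition measurable_mx (A : T -> 'M[R]_n) : Prop :=
  forall p q, measurable_fun setT (fun x => A x p q).

Lemma measurable_mx_mul (A B : T -> 'M[R]_n) : measurable_mx A -> measurable_mx B ->
  measurable_mx (fun x => A x *m B x).
Proof.
move=> mA mB p q; under eq_fun do rewrite mxE.
by apply: measurable_sum => j; exact: measurable_funM.
Qed.

Lemma measurable_mx_add (A B : T -> 'M[R]_n) : measurable_mx A -> measurable_mx B ->
  measurable_mx (fun x => A x + B x).
Proof. by move=> mA mB p q; under eq_fun do rewrite mxE; exact: measurable_funD. Qed.

Lemma measurable_mx_scale (t : R) (A : T -> 'M[R]_n) : measurable_mx A ->
  measurable_mx (fun x => t *: A x).
Proof.
move=> mA p q; under eq_fun do rewrite mxE.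
by apply: measurable_funM => //; exact: measurable_cst.
Qed.

Lemma measurable_mx_cst (A : 'M[R]_n) : measurable_mx (fun=> A).
Proof. by move=> p q; exact: measurable_cst. Qed.

Lemma measurable_mx_sum (I : eqType) (r : seq I) (A : I -> T -> 'M[R]_n) :
  (forall i, i \in r -> measurable_mx (A i)) -> measurable_mx (fun x => \sum_(i <- r) A i x).
Proof.
elim: r => [|i r IH] mA; first by under eq_fun do rewrite big_nil; exact: measurable_mx_cst.
under eq_fun do rewrite big_cons; apply: measurable_mx_add; first exact/mA/mem_head.
by apply: IH => j jr; apply: mA; rewrite in_cons jr orbT.
Qed.

Lemma measurable_mx_iter k (A : T -> 'M[R]_n) : measurable_mx A ->
  measurable_mx (fun x => iter k (mulmx (A x)) 1%:M).
Proof.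
move=> mA; elim: k => [|k IH]; first exact: measurable_mx_cst.
exact: measurable_mx_mul.
Qed.

Lemma measurable_mxtrace (A : T -> 'M[R]_n) : measurable_mx A ->
  measurable_fun setT (fun x => \tr (A x)).
Proof. by move=> mA; apply: measurable_sum => i; exact: mA. Qed.

Lemma measurable_mxtrace_expm (A : T -> 'M[R]_n) : measurable_mx A ->
  (forall x, (A x)^T = A x) -> measurable_fun setT (fun x => \tr (expm (A x))).
Proof.
move=> mA sA.
apply: (@measurable_fun_cvg _ _ _ _ (fun N x => \sum_(0 <= k < N) \tr (iter k (mulmx (A x)) 1%:M) / k`!%:R)).
  move=> N; apply: measurable_sum => k; apply: measurable_funM; last exact: measurable_cst.
  exact/measurable_mxtrace/measurable_mx_iter.
by move=> x _; exact: mxtrace_expm_cvg.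
Qed.
End MeasurableTraceExp.

(** * Fubini's theorem for two independent variables *)

Section IndependentPair.
Local Open Scope ereal_scope.
Context (R : realType) (dO d1 d2 : measure_display) (Omega : measurableType dO)
  (S1 : measurableType d1) (S2 : measurableType d2) (P : probability Omega R).

(** The joint law equals the product of the two laws because they agree on rectangles. [S2] carries
    its own sigma-algebra: later it is [Omega] with a coarser one and [Z] is the identity. *)
Lemma independent_fubini (X : Omega -> S1) (Z : Omega -> S2) (F : S1 * S2 -> \bar R) :
  measurable_fun setT X -> measurable_fun setT Z ->
  (forall A B, measurable A -> measurable B ->
    P (X @^-1` A `&` Z @^-1` B) = P (X @^-1` A) * P (Z @^-1` B)) ->
  measurable_fun setT F -> (forall z, 0 <= F z) ->
  \int[P]_w F (X w, Z w) = \int[P]_w \int[P]_w' F (X w, Z w').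
Proof.
move=> mX mZ ind mF F0.
pose X' : {mfun Omega >-> S1} := HB.pack X (isMeasurableFun.Build _ _ _ _ _ mX).
pose Z' : {mfun Omega >-> S2} := HB.pack Z (isMeasurableFun.Build _ _ _ _ _ mZ).
have mXZ : measurable_fun setT (fun w => (X w, Z w)) by exact: measurable_fun_pair.
pose XZ : {mfun Omega >-> (S1 * S2)%type} :=
  HB.pack (fun w => (X w, Z w)) (isMeasurableFun.Build _ _ _ _ _ mXZ).
have E A : measurable A ->
    (distribution P X' \x distribution P Z') A = distribution P XZ A.
  apply: product_measure_unique => B C mB mC.
  by rewrite /distribution /pushforward /=; exact: ind.
transitivity (\int[distribution P XZ]_z F z).
  by rewrite (@ge0_integral_distribution _ _ _ _ _ P XZ).
transitivity (\int[distribution P X' \x distribution P Z']_z F z).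
  by apply: eq_measure_integral => A mA _; exact/esym/E.
rewrite fubini_tonelli1//.
rewrite (@ge0_integral_distribution _ _ _ _ _ P X'); last 2 first.
- exact: measurable_fun_fubini_tonelli_F.
- by move=> x; apply: integral_ge0.
apply: eq_integral => w _; rewrite /= /fubini_F.
rewrite (@ge0_integral_distribution _ _ _ _ _ P Z')//.
exact: measurableT_comp.
Qed.
End IndependentPair.

(** * Orthogonal projections and the matrix moment generating function of one sample *)

Section Projection.
Variables (R : realType) (n : nat).
Implicit Types Q : 'M[R]_n.

Definition is_proj Q : Prop := Q^T = Q /\ Q *m Q = Q.

(** The eigenvalues are 0 and 1, where [exp (lam p)] agrees with its chord. The result is affine in
    [Q], so its mean is determined by the mean of [Q]. *)
Lemma expm_proj Q (lam : R) : is_proj Q -> expm (lam *: Q) = 1%:M + (expR lam - 1) *: Q.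
Proof.
move=> [/smxP[U [p oU ->]]]; rewrite smxM// => /(smx_inj oU) pp.
rewrite -smxZ expm_smx// -(smx1 oU) -smxZ -smxD; congr smx; apply/rowP => i.
have := congr1 (fun v : 'rV[R]_n => v 0 i) pp; rewrite !mxE => /eqP.
rewrite -subr_eq0 -{3}[p 0 i]mulr1 -mulrBr mulf_eq0 subr_eq0 => /orP[]/eqP ->.
  by rewrite !mulr0 expR0 addr0.
by rewrite !mulr1 addrC subrK.
Qed.

Lemma proj_qform Q (v : 'rV[R]_n) : is_proj Q ->
  0 <= (v *m Q *m v^T) 0 0 <= (v *m v^T) 0 0.
Proof.
move=> [sQ QQ].
have E1 : v *m Q *m v^T = (v *m Q) *m (v *m Q)^T.
  by rewrite trmx_mul sQ mulmxA -[v *m Q *m Q]mulmxA QQ.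
have E2 : v *m v^T - v *m Q *m v^T = (v - v *m Q) *m (v - v *m Q)^T.
  rewrite linearB /= mulmxBl !mulmxBr !trmx_mul sQ !mulmxA -[v *m Q *m Q]mulmxA QQ.
  by rewrite subrr subr0.
apply/andP; split; first by rewrite E1 row_sqnormE; apply: sumr_ge0 => i _; exact: sqr_ge0.
rewrite -subr_ge0; have -> : (v *m v^T) 0 0 - (v *m Q *m v^T) 0 0 =
  (v *m v^T - v *m Q *m v^T) 0 0 by rewrite [RHS]mxE; congr (_ + _); rewrite [RHS]mxE.
by rewrite E2 row_sqnormE; apply: sumr_ge0 => i _; exact: sqr_ge0.
Qed.

Lemma proj_entry_le1 Q p q : is_proj Q -> `|Q p q| <= 1.
Proof.
move=> [sQ QQ].
have E p' : Q p' p' = \sum_j Q p' j ^+ 2.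
  by rewrite -{1}QQ mxE; apply: eq_bigr => j _; rewrite -{2}sQ mxE.
have h p' q' : Q p' q' ^+ 2 <= Q p' p'.
  by rewrite E (bigD1 q')//= lerDl; apply: sumr_ge0 => j _; exact: sqr_ge0.
have pp := h p p; have pq := h p q.
have p1 : Q p p <= 1 by nra.
rewrite -(@ler_pXn2r _ 2)// ?nnegrE// real_normK ?num_real// expr1n.
exact: le_trans pq p1.
Qed.
End Projection.

Section RealExpectation.
Context (R : realType) (d : measure_display) (T : measurableType d)
  (mu : {measure set T -> \bar R}).

Lemma integrable_addR (f g : T -> R) : mu.-integrable setT (EFin \o f) ->
  mu.-integrable setT (EFin \o g) -> mu.-integrable setT (EFin \o (fun x => f x + g x)).
Proof. exact: (@integrableD _ _ _ _ _ measurableT (EFin \o f) (EFin \o g)). Qed.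

Lemma integrable_scaleR (c : R) (f : T -> R) : mu.-integrable setT (EFin \o f) ->
  mu.-integrable setT (EFin \o (fun x => c * f x)).
Proof. exact: (@integrableZl _ _ _ _ _ measurableT c (EFin \o f)). Qed.

Lemma Rintegral_sum (I : Type) (r : seq I) (F : I -> T -> R) :
  (forall i, mu.-integrable setT (EFin \o F i)) ->
  mu.-integrable setT (EFin \o (fun x => \sum_(i <- r) F i x)) /\
  \int[mu]_x (\sum_(i <- r) F i x) = \sum_(i <- r) \int[mu]_x F i x.
Proof.
move=> iF; elim: r => [|i r [IH1 IH2]].
  under eq_fun do rewrite big_nil; split.
    exact: integrable0.
  by rewrite big_nil /Rintegral integral0.
under eq_fun do rewrite big_cons; split.
  exact: integrable_addR.
by rewrite big_cons RintegralD// IH2.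
Qed.

Lemma Rintegral_mxtrace (n : nat) (Q : T -> 'M[R]_n) (M : 'M[R]_n) :
  (forall p q, mu.-integrable setT (EFin \o (fun x => Q x p q))) ->
  mu.-integrable setT (EFin \o (fun x => \tr (M *m Q x))) /\
  \int[mu]_x (\tr (M *m Q x)) = \tr (M *m (\matrix_(p, q) \int[mu]_x (Q x p q))).
Proof.
move=> iQ.
have i1 p q : mu.-integrable setT (EFin \o (fun x => M p q * Q x q p)).
  exact: integrable_scaleR.
have i2 p := Rintegral_sum (index_enum _) (i1 p).
have [i3 E3] := Rintegral_sum (index_enum _) (fun p => (i2 p).1).
have E : (fun x => \tr (M *m Q x)) = fun x => \sum_p \sum_q M p q * Q x q p.
  by apply/funext => x; apply: eq_bigr => p _; rewrite mxE.
rewrite E; split => //; rewrite E3; apply: eq_bigr => p _; rewrite (i2 p).2 mxE.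
by apply: eq_bigr => q _; rewrite RintegralZl// mxE.
Qed.
End RealExpectation.

Lemma Rintegral_prob_cst (R : realType) (d : measure_display) (T : measurableType d)
  (P : probability T R) (r : R) : \int[P]_x r = r.
Proof. by rewrite Rintegral_cst// [X in fine X](probability_setT P) mulr1. Qed.

Section MatrixMGF.
Context (R : realType) (n : nat) (dO : measure_display) (Omega : measurableType dO)
  (P : probability Omega R).

Definition mean_mx (Q : Omega -> 'M[R]_n) : 'M[R]_n := \matrix_(p, q) \int[P]_w Q w p q.

Lemma proj_integrable (Q : Omega -> 'M[R]_n) p q : measurable_mx Q ->
  (forall w, is_proj (Q w)) -> P.-integrable setT (EFin \o (fun w => Q w p q)).
Proof.
move=> mQ pQ; apply: measurable_bounded_integrable => //.
  by apply: le_lt_trans (probability_le1 P measurableT) _; rewrite ltry.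
by exists 1; split => // M M1 w _; apply: le_trans (ltW M1); exact: proj_entry_le1.
Qed.

Lemma mean_mx_sym (Q : Omega -> 'M[R]_n) : (forall w, (Q w)^T = Q w) ->
  (mean_mx Q)^T = mean_mx Q.
Proof.
move=> sQ; apply/matrixP => p q; rewrite !mxE; apply: eq_Rintegral => w _.
by rewrite -[in LHS]sQ mxE.
Qed.

(** The eigenvalue is the mean of the quadratic form of [Q] at a unit eigenvector. The range makes
    [1 + (exp lam - 1) a] positive, so that its logarithm can be taken in [mgf_proj]. *)
Lemma mean_proj_eigen (Q : Omega -> 'M[R]_n) (U : 'M[R]_n) (a : 'rV[R]_n) i :
  measurable_mx Q -> (forall w, is_proj (Q w)) -> orth U -> mean_mx Q = smx U a ->
  0 <= a 0 i <= 1.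
Proof.
move=> mQ pQ oU E; pose u := row i U.
have uu : (u *m u^T) 0 0 = 1.
  by rewrite row_sqnormE -(orth_row i oU); apply: eq_bigr => j _; rewrite mxE.
have trq (A : 'M[R]_n) : \tr (u^T *m u *m A) = (u *m A *m u^T) 0 0.
  by rewrite -mulmxA mxtrace_mulC /mxtrace big_ord_recl big_ord0 addr0.
have Ea : a 0 i = \tr (u^T *m u *m mean_mx Q).
  rewrite trq E smx_qform (bigD1 i)//= big1 => [|j ji]; rewrite /u rowE -mulmxA oU -rowE.
    by rewrite !mxE eqxx expr1n mulr1 addr0.
  by rewrite !mxE eq_sym (negbTE ji) expr0n mulr0.
have [i1 E1] := Rintegral_mxtrace (u^T *m u) (fun p q => proj_integrable p q mQ pQ).
have h w : 0 <= \tr (u^T *m u *m Q w) <= 1 by rewrite trq -uu; exact: proj_qform.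
rewrite Ea -E1; apply/andP; split.
  by apply: Rintegral_ge0 => w _; case/andP: (h w).
have -> : 1 = \int[P]_w (1 : R) by rewrite Rintegral_prob_cst.
apply: le_Rintegral => //; first exact: finite_measure_integrable_cst.
by move=> w _; case/andP: (h w).
Qed.

(** The hyperplane of [lieb] is placed at [expm L0], the mean of [expm (lam *: Q)]. Being linear, it
    integrates to its value there, [tr exp (H + L0)]; then $\ln (1 + y) \le y$ replaces [L0] by
    [(expR lam - 1) *: mean_mx Q]. *)
Lemma mgf_proj (Q : Omega -> 'M[R]_n) (H : 'M[R]_n) (lam : R) :
  measurable_mx Q -> (forall w, is_proj (Q w)) -> H^T = H ->
  (\int[P]_w (\tr (expm (H + lam *: Q w)))%:E
    <= (\tr (expm (H + (expR lam - 1) *: mean_mx Q)))%:E)%E.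
Proof.
move=> mQ pQ sH; pose c := expR lam - 1.
have sA : (mean_mx Q)^T = mean_mx Q by apply: mean_mx_sym => w; case: (pQ w).
have [U [a oU EA]] := smxP sA.
have a01 i := mean_proj_eigen i mQ pQ oU EA.
have ca i : 0 < 1 + c * a 0 i.
  have := expR_gt0 lam; have := a01 i => /andP[]; rewrite /c; nra.
pose L0 := smx U (\row_i ln (1 + c * a 0 i)).
have EL0 : expm L0 = 1%:M + c *: mean_mx Q.
  rewrite /L0 expm_smx// EA -(smx1 oU) -smxZ -smxD; congr smx; apply/rowP => i.
  by rewrite !mxE lnK// posrE.
have [M [hM eM]] := lieb sH (smx_sym _ _ : L0^T = L0).
have sQ w : (Q w)^T = Q w by case: (pQ w).
have bound w : \tr (expm (H + lam *: Q w)) <= \tr M + c * \tr (M *m Q w).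
  apply: le_trans (hM (lam *: Q w) _) _; first by rewrite linearZ /= sQ.
  by rewrite expm_proj// mulmxDr mulmx1 mxtraceD -scalemxAr mxtraceZ.
have [i1 E1] := Rintegral_mxtrace M (fun p q => proj_integrable p q mQ pQ).
have i2 : P.-integrable setT (EFin \o (fun w => c * \tr (M *m Q w))).
  exact: integrable_scaleR.
have i3 : P.-integrable setT (EFin \o (fun=> \tr M)).
  exact: finite_measure_integrable_cst.
have i4 : P.-integrable setT (EFin \o (fun w => \tr M + c * \tr (M *m Q w))).
  exact: integrable_addR.
apply: (@le_trans _ _ (\int[P]_w (\tr M + c * \tr (M *m Q w))%:E)%E).
  apply: ge0_le_integralW => w; rewrite lee_fin//.
  by apply: mxtrace_expm_ge0; rewrite linearD linearZ /= sQ sH.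
rewrite -[leLHS]fineK ?lee_fin; last exact: integrable_fin_num.
rewrite -/(Rintegral P setT (fun w => \tr M + c * \tr (M *m Q w))).
rewrite RintegralD// RintegralZl// E1 Rintegral_prob_cst.
have -> : \tr M + c * \tr (M *m (\matrix_(p, q) \int[P]_x Q x p q)) = \tr (expm (H + L0)).
  by rewrite -eM EL0 mulmxDr mulmx1 mxtraceD -scalemxAr mxtraceZ.
have sHL : (H + L0)^T = H + L0 by rewrite linearD /= sH smx_sym.
(* Monotonicity of the trace exponential: by Klein's inequality it suffices that the difference of
   the exponents has eigenvalues $y - \ln (1 + y) \ge 0$. *)
apply: le_trans (klein _ sHL); last by rewrite linearD linearZ /= sH sA.
rewrite lerDl opprD addrACA subrr add0r EA -/c -smxZ -[- L0]scaleN1r /L0 -smxZ -smxD.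
apply: mxtrace_expm_mul_ge0 => // i; rewrite !mxE mulN1r subr_ge0.
by have := le_ln1Dx (x := c * a 0 i); apply; have := ca i; lra.
Qed.
End MatrixMGF.

(** * Independence of one sample from all the others *)

Section IndependentFamily.
Context (R : realType) (dO : measure_display) (Omega : measurableType dO)
  (P : probability Omega R) (d : measure_display) (T : measurableType d)
  (I : finType) (X : I -> Omega -> T).
Hypothesis mX : forall i, measurable_fun setT (X i).
Hypothesis indX : independent P X.
Implicit Types (s : seq I) (i : I).

Definition cylinder s (A : I -> set T) : set Omega :=
  \bigcap_(j in [set` s]) (X j @^-1` A j).

Definition cylinders s : set (set Omega) :=
  [set E | exists2 A : I -> set T, (forall j, measurable (A j)) & E = cylinder s A].

Lemma measurable_preimage i (A : set T) : measurable A -> measurable (X i @^-1` A).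
Proof. by move=> mA; rewrite -[_ @^-1` _]setTI; exact: mX. Qed.

Lemma measurable_cylinder s A : (forall j, measurable (A j)) -> measurable (cylinder s A).
Proof.
move=> mA; apply: fin_bigcap_measurable => [|j _]; last exact: measurable_preimage.
exact: finite_seq.
Qed.

Lemma cylinder_prod s A : uniq s -> (forall j, measurable (A j)) ->
  P (cylinder s A) = (\prod_(j <- s) fine (P (X j @^-1` A j)))%:E.
Proof.
move=> us mA; pose A' j := if j \in s then A j else setT.
have -> : cylinder s A = \bigcap_(j in [set: I]) (X j @^-1` A' j).
  apply/seteqP; split => w h j; rewrite /A'.
    by move=> _; case: ifPn => // js; exact: h.
  by move=> /= js; have := h j Logic.I; rewrite /A' js.
rewrite indX; last by move=> j; rewrite /A'; case: ifPn.
congr (_%:E); rewrite [RHS](big_uniq _ us) [RHS]big_mkcond /=; apply: eq_bigr => j _.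
rewrite /A'; case: ifPn => // _.
by rewrite preimage_setT [X in fine X](probability_setT P).
Qed.

Lemma preimage_cylinder s i (A : set T) : i \in s ->
  X i @^-1` A = cylinder s (fun j => if j == i then A else setT).
Proof.
move=> si; apply/seteqP; split => w h.
  by move=> j _ /=; case: eqP => // ->.
by have := h i si; rewrite /= eqxx.
Qed.

Lemma cylinder_cons s i (B : set T) (A : I -> set T) : i \notin s ->
  X i @^-1` B `&` cylinder s A = cylinder (i :: s) (fun j => if j == i then B else A j).
Proof.
move=> si; apply/seteqP; split => w.
  move=> [wB wA] j /=; rewrite in_cons; case: eqP => [-> //|_ /= js]; exact: wA.
move=> h; split; first by have := h i (mem_head _ _); rewrite /= eqxx.
move=> j /= js; have := h j; rewrite /= in_cons js orbT => /(_ isT).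
by case: eqP => // ji; move: si; rewrite -ji js.
Qed.

(** Cylinders are stable under intersection and satisfy the product formula, so Dynkin's lemma
    extends it to the sigma-algebra they generate. Measurability in [Omega] travels along in the
    same induction; it makes the identity into the coarser space measurable. *)
Lemma independent_rest s i (B : set T) (E : set Omega) : uniq (i :: s) -> measurable B ->
  <<s cylinders s >> E ->
  measurable E /\ P (X i @^-1` B `&` E) = (P (X i @^-1` B) * P E)%E.
Proof.
move=> /=/andP[nis us] mB.
have mXB := measurable_preimage i mB.
have fP (A : set Omega) : measurable A -> P A \is a fin_num.
  by move=> mA; exact: fin_num_measure.
apply: (@dynkin_induction _ (g_sigma_algebraType (cylinders s)) (cylinders s)
  (fun E : set Omega => measurable E /\ P (X i @^-1` B `&` E) = (P (X i @^-1` B) * P E)%E)).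
- by [].
- move=> _ _ [A mA ->] [A' mA' ->]; exists (fun j => A j `&` A' j).
    by move=> j; exact: measurableI.
  apply/seteqP; split => w; first by move=> [h h'] j js; split; [exact: h|exact: h'].
  by move=> h; split => j js; have [] := h j js.
- by split => //; rewrite setIT [X in (_ * X)%E](probability_setT P) mule1.
- move=> _ [A mA ->]; split; first exact: measurable_cylinder.
  rewrite cylinder_cons// cylinder_prod /=; last 2 first.
  + by rewrite nis.
  + by move=> j; case: ifP.
  rewrite cylinder_prod// big_cons eqxx EFinM fineK ?fP//; congr (_ * _%:E)%E.
  rewrite big_seq [RHS]big_seq; apply: eq_bigr => j js.
  by case: eqP => // ji; move: nis; rewrite -ji js.
- move=> S0 _; move: (S0 : set Omega) => S [mS PS]; split; first exact: measurableC.
  have -> : X i @^-1` B `&` ~` S = X i @^-1` B `\` (X i @^-1` B `&` S).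
    by rewrite setDE setCI setIUr setICr set0U.
  rewrite measureD//; last 2 first.
  + exact: measurableI.
  + by rewrite ltey_eq fP.
  rewrite (_ : _ `&` (_ `&` S) = X i @^-1` B `&` S) ?PS; last by rewrite setIA setIid.
  have -> : P (~` S) = (1 - P S)%E by exact: probability_setC.
  by rewrite muleBr ?mule1 ?fP// -PS.
- move=> F0 _; move: (F0 : (set Omega)^nat) => F tF hF.
  have mF k : measurable (F k) by case: (hF k).
  split; first exact: bigcupT_measurable.
  rewrite setI_bigcupr !measure_bigcup//=; last 2 first.
  + by move=> k _; exact: measurableI.
  + by apply: trivIset_setIl.
  rewrite -[P (X i @^-1` B)](fineK (fP _ mXB)) -nneseriesZl//.
  by apply: eq_eseriesr => k _; rewrite (fineK (fP _ mXB)); case: (hF k).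
Qed.
End IndependentFamily.

(** * Integration against a measure given by a density *)

Section Density.
Local Open Scope ereal_scope.
Context (R : realType) (d : measure_display) (T : measurableType d)
  (mu nu : {measure set T -> \bar R}) (g : T -> R).
Hypotheses (mg : measurable_fun setT g) (g0 : forall x, (0 <= g x)%R).
Hypothesis nuE : forall A, measurable A -> nu A = \int[mu]_(x in A) (g x)%:E.

Import HBNNSimple.

Lemma integral_density_nnsfun (h : {nnsfun T >-> R}) :
  \int[nu]_x (h x)%:E = \int[mu]_x ((h x)%:E * (g x)%:E).
Proof.
have mg' : measurable_fun setT (fun x => (g x)%:E) by exact/measurable_EFinP.
under [LHS]eq_integral do rewrite fimfunE -fsumEFin//.
rewrite [LHS]ge0_integral_fsum//; last 2 first.
  - by move=> r; exact/measurable_EFinP/measurableT_comp.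
  - by move=> n x _; rewrite EFinM nnfun_muleindic_ge0.
under [RHS]eq_integral.
  move=> x xD; rewrite fimfunE -fsumEFin// muleC ge0_mule_fsumr; last first.
    by move=> r; rewrite EFinM nnfun_muleindic_ge0.
  over.
have mr r : measurable_fun setT (fun x => (r * \1_(h @^-1` [set r]) x)%:E).
  exact/measurable_EFinP/measurableT_comp.
rewrite [RHS]ge0_integral_fsum//; last 2 first.
  - by move=> r; apply: emeasurable_funM.
  - move=> r x _; apply: mule_ge0; first by rewrite lee_fin.
    by rewrite EFinM nnfun_muleindic_ge0.
apply: eq_fsbigr => r _; rewrite integralZl_indic_nnsfun//= integral_indic// setIT nuE//.
have [r0|r0] := ltP r 0%R.
  rewrite preimage_nnfun0// integral_set0 mule0 integral0_eq// => x _.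
  by rewrite indic0 mulr0 mule0.
rewrite [in LHS]integral_mkcond -ge0_integralZl//.
- apply: eq_integral => x _; rewrite patchE indicE; case: ifPn => _ /=.
    by rewrite mulr1 muleC.
  by rewrite mulr0 !mule0.
- by apply/(measurable_restrictT _ _).1 => //; exact: measurable_funTS.
- by move=> x _; rewrite patchE; case: ifPn; rewrite // lee_fin.
Qed.

Lemma ge0_integral_density (f : T -> \bar R) : measurable_fun setT f ->
  (forall x, 0 <= f x) -> \int[nu]_x f x = \int[mu]_x (f x * (g x)%:E).
Proof.
move=> mf f0; pose f_ := nnsfun_approx measurableT mf.
have mg' : measurable_fun setT (fun x => (g x)%:E) by exact/measurable_EFinP.
transitivity (lim (\int[nu]_x (f_ n x)%:E @[n --> \oo])).
  rewrite -monotone_convergence//=.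
  - apply: eq_integral => ? /[!inE] xD; apply/esym/cvg_lim => //=.
    exact: cvg_nnsfun_approx.
  - by move=> n; exact/measurable_EFinP/measurable_funTS.
  - by move=> n ? _; rewrite lee_fin.
  - by move=> ? _ ? ? mn; rewrite lee_fin; exact/lefP/nd_nnsfun_approx.
under eq_fun do rewrite integral_density_nnsfun.
rewrite -monotone_convergence//=.
- apply: eq_integral => x _; apply/cvg_lim => //=; apply: cvgeZr => //.
  exact: cvg_nnsfun_approx.
- move=> n; apply: emeasurable_funM => //.
  exact/measurable_EFinP/measurable_funTS.
- by move=> n x _; rewrite mule_ge0// lee_fin.
- move=> x _ a b ab; apply: lee_wpmul2r; rewrite lee_fin//.
  exact/lefP/nd_nnsfun_approx.
Qed.
End Density.

(** * Moment generating function of a sum of independent projections *)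

Section IndependentMGF.
Context (R : realType) (dO : measure_display) (Omega : measurableType dO)
  (P : probability Omega R) (d : measure_display) (T : measurableType d)
  (I : finType) (X : I -> Omega -> T).
Hypothesis mX : forall i, measurable_fun setT (X i).
Hypothesis indX : independent P X.

(** Induction on the samples: the first one is held fixed and absorbed into [H], the induction
    hypothesis averages the others, and [mgf_proj] then averages the first. Hence [H] must be
    arbitrary. *)
Lemma mgf_independent_sum (n : nat) (Q : T -> 'M[R]_n) (lam : R) (s : seq I) (H : 'M[R]_n) :
  measurable_mx Q -> (forall x, is_proj (Q x)) -> uniq s -> H^T = H ->
  (\int[P]_w (\tr (expm (H + lam *: \sum_(j <- s) Q (X j w))))%:E
   <= (\tr (expm (H + (expR lam - 1) *: \sum_(j <- s) mean_mx P (Q \o X j))))%:E)%E.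
Proof.
move=> mQ pQ; have sQ x : (Q x)^T = Q x by case: (pQ x).
have sS r w : (\sum_(j <- r) Q (X j w))^T = \sum_(j <- r) Q (X j w).
  by rewrite linear_sum; apply: eq_bigr => j _; exact: sQ.
elim: s H => [|i s IH] H us sH.
  under eq_integral do rewrite big_nil scaler0 addr0.
  by rewrite big_nil scaler0 addr0 integral_cst// [X in (_ * X)%E](probability_setT P) mule1.
(* [Omega] with the sigma-algebra generated by the samples in [s]: it plays the part of the joint
   value of those samples. *)
pose S := g_sigma_algebraType (cylinders X s).
pose F (z : T * S) : \bar R := (\tr (expm (H + lam *: Q z.1 +
  lam *: \sum_(j <- s) Q (X j z.2))))%:E.
have symF z w : (H + lam *: Q z + lam *: \sum_(j <- s) Q (X j w))^T =
    H + lam *: Q z + lam *: \sum_(j <- s) Q (X j w).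
  by rewrite !linearD !linearZ /= sS sQ sH.
have mXS j : j \in s -> measurable_fun setT (X j : S -> T).
  move=> js _ B mB; rewrite setTI; apply: sub_sigma_algebra.
  exists (fun l => if l == j then B else setT); last exact: preimage_cylinder.
  by move=> l; case: ifP.
have mF : measurable_fun setT F.
  apply/measurable_EFinP; apply: (@measurable_mxtrace_expm _ _ _ _ (fun z : T * S =>
     H + lam *: Q z.1 + lam *: \sum_(j <- s) Q (X j z.2))); last by move=> z; exact: symF.
  apply: measurable_mx_add; last first.
    apply: measurable_mx_scale; apply: measurable_mx_sum => j js p q.
    by apply: measurableT_comp (mQ p q) _; exact: measurableT_comp (mXS j js) _.
  apply: measurable_mx_add; first exact: measurable_mx_cst.
  by apply: measurable_mx_scale => p q; exact: measurableT_comp (mQ p q) _.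
have F0 z : (0 <= F z)%E by rewrite lee_fin; apply: mxtrace_expm_ge0; exact: symF.
have mid : measurable_fun setT (idfun : Omega -> S).
  by move=> _ B mB; rewrite setTI; have [] := independent_rest mX indX us measurableT mB.
have ind A B : measurable A -> measurable B ->
    P (X i @^-1` A `&` (idfun : Omega -> S) @^-1` B) =
    (P (X i @^-1` A) * P ((idfun : Omega -> S) @^-1` B))%E.
  by move=> mA mB; have [] := independent_rest mX indX us mA mB.
have -> : (\int[P]_w (\tr (expm (H + lam *: \sum_(j <- i :: s) Q (X j w))))%:E =
    \int[P]_w F (X i w, (idfun w : S)))%E.
  by apply: eq_integral => w _; rewrite big_cons scalerDr addrA.
rewrite (independent_fubini (mX i) mid ind mF F0).
pose A j := mean_mx P (Q \o X j); pose c := expR lam - 1.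
have sA j : (A j)^T = A j by apply: mean_mx_sym => w; exact: sQ.
have sH' : (H + c *: \sum_(j <- s) A j)^T = H + c *: \sum_(j <- s) A j.
  by rewrite linearD linearZ /= linear_sum /= sH; under eq_bigr do rewrite sA.
have mQi : measurable_mx (Q \o X i) by move=> p q; exact: measurableT_comp (mQ p q) _.
apply: (@le_trans _ _ (\int[P]_w (\tr (expm ((H + c *: \sum_(j <- s) A j) +
    lam *: (Q \o X i) w)))%:E)%E).
  apply: ge0_le_integralW => w; first by apply: integral_ge0 => w' _; exact: F0.
  have -> : H + c *: \sum_(j <- s) A j + lam *: (Q \o X i) w =
    (H + lam *: Q (X i w)) + c *: \sum_(j <- s) A j by rewrite addrAC.
  have us' : uniq s by case/andP: us.
  have sHw : (H + lam *: Q (X i w))^T = H + lam *: Q (X i w).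
    by rewrite linearD linearZ /= sH sQ.
  exact: (IH _ us' sHw).
have pQi w : is_proj ((Q \o X i) w) by exact: pQ.
have h := mgf_proj P lam mQi pQi sH'; apply: (le_trans h).
by rewrite big_cons scalerDr addrAC -addrA.
Qed.
End IndependentMGF.

(** * Spectral norm and the matrix Chernoff bound *)

Section SpectralNorm.
Context (R : realType) (n : nat).
Implicit Types (A U : 'M[R]_n) (a : 'rV[R]_n) (v : 'cV[R]_n) (r : R).

Lemma eucl_ge0 v : 0 <= eucl v.
Proof. exact: sqrtr_ge0. Qed.

Lemma sqr_eucl v : eucl v ^+ 2 = \sum_i v i 0 ^+ 2.
Proof. by rewrite sqr_sqrtr// sumr_ge0// => i _; exact: sqr_ge0. Qed.

Lemma sqr_euclE v : eucl v ^+ 2 = (v^T *m v) 0 0.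
Proof. by rewrite sqr_eucl mxE; apply: eq_bigr => i _; rewrite mxE expr2. Qed.

Lemma eucl_smx_le U a r v : orth U -> 0 <= r -> (forall i, `|a 0 i| <= r) ->
  eucl (smx U a *m v) <= r * eucl v.
Proof.
move=> oU r0 ar; rewrite -(@ler_pXn2r _ 2)// ?nnegrE ?mulr_ge0 ?eucl_ge0//.
rewrite exprMn !sqr_euclE trmx_mul smx_sym mulmxA -[_ *m smx U a *m smx U a]mulmxA smxM//.
have E (b : 'rV[R]_n) : (v^T *m smx U b *m v) 0 0 = \sum_i b 0 i * (v^T *m U^T) 0 i ^+ 2.
  by rewrite -[X in _ *m X]trmxK smx_qform.
have -> : v^T *m v = v^T *m smx U (const_mx 1) *m v by rewrite smx1// mulmx1.
rewrite !E mulr_sumr; apply: ler_sum => i _; rewrite [leRHS]mulrA; apply: ler_wpM2r.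
  exact: sqr_ge0.
rewrite !mxE mulr1 -expr2 -(real_normK (num_real (a 0 i))).
by rewrite ler_pXn2r ?nnegrE.
Qed.

Lemma specnorm_smx_leP U a r : orth U -> (0 < n)%N -> 0 <= r ->
  specnorm (smx U a) <= r <-> forall i, `|a 0 i| <= r.
Proof.
move=> oU n0 r0.
pose E i : 'cV[R]_n := (row i U)^T.
have E1 i : eucl (E i) = 1.
  rewrite /eucl -[RHS]sqrtr1; congr Num.sqrt; rewrite -(orth_row i oU).
  by apply: eq_bigr => j _; rewrite !mxE.
have AE i : smx U a *m E i = a 0 i *: E i.
  rewrite /E -(trmxK (smx U a *m _)) trmx_mul trmxK smx_sym -[RHS]trmxK; congr trmx.
  rewrite linearZ /= trmxK rowE /smx !mulmxA -[delta_mx 0 i *m U *m U^T]mulmxA oU mulmx1.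
  by rewrite -!rowE row_diag_mx -scalemxAl -rowE.
have hb : has_ubound [set eucl (smx U a *m v) | v in [set v : 'cV[R]_n | eucl v = 1]].
  exists (\sum_i `|a 0 i|) => _ [v /= v1 <-]; rewrite -[leRHS]mulr1 -v1.
  apply: eucl_smx_le => //; first exact: sumr_ge0.
  by move=> i; rewrite (bigD1 i)//= lerDl; exact: sumr_ge0.
split => [h i|h].
  apply: le_trans h; have -> : `|a 0 i| = eucl (smx U a *m E i).
    rewrite AE; apply/eqP; rewrite -(@eqrXn2 _ 2)// ?eucl_ge0// real_normK ?num_real//.
    rewrite sqr_eucl; have := E1 i => /(congr1 (fun x => x ^+ 2)); rewrite sqr_eucl expr1n => e1.
    apply/eqP; rewrite -[LHS]mulr1 -e1 mulr_sumr; apply: eq_bigr => j _.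
    by rewrite [in RHS]mxE exprMn.
  by apply: sup_ubound => //; exists (E i) => //=; exact: E1.
apply: ge_sup; first by exists (eucl (smx U a *m E (Ordinal n0))); exists (E (Ordinal n0)) => //=; exact: E1.
by move=> _ [v /= v1 <-]; rewrite -[leRHS]mulr1 -v1; exact: eucl_smx_le.
Qed.

Lemma specnorm_bound A r v : A^T = A -> (0 < n)%N -> 0 <= r -> specnorm A <= r ->
  eucl (A *m v) <= r * eucl v.
Proof.
by move=> /smxP[U [a oU ->]] n0 r0 /(specnorm_smx_leP _ oU n0 r0) h; exact: eucl_smx_le.
Qed.

Lemma bernoulli_ineq (x : R) k : 0 <= x -> 1 + k%:R * x <= (1 + x) ^+ k.
Proof.
move=> x0; elim: k => [|k IH]; first by rewrite mul0r addr0 expr0.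
rewrite exprS; apply: le_trans (ler_wpM2l _ IH); last lra.
have : 0 <= k%:R * x ^+ 2 by rewrite mulr_ge0 ?sqr_ge0.
rewrite -natr1; nra.
Qed.

(* This exhibits the event as a countable intersection of polynomial conditions, hence
   as a measurable set. *)
Lemma specnorm_half_powers A : A^T = A -> (0 < n)%N ->
  specnorm A <= 2^-1 <->
  forall k, \tr (iter (2 * k) (mulmx (2 *: A)) 1%:M) <= n%:R.
Proof.
move=> /smxP[U [a oU ->]] n0; rewrite (specnorm_smx_leP _ oU n0) ?invr_ge0//.
have E k : \tr (iter (2 * k) (mulmx (2 *: smx U a)) 1%:M) = \sum_i ((2 * a 0 i) ^+ 2) ^+ k.
  rewrite -smxZ iter_mulmx_smx// mxtrace_smx//; apply: eq_bigr => i _.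
  by rewrite !mxE exprM.
split => [h k|h i].
  rewrite E -[X in _ <= X%:R]card_ord -sumr_const; apply: ler_sum => i _.
  rewrite exprn_ile1 ?sqr_ge0//; have := h i; rewrite ler_norml => /andP[]; nra.
rewrite leNgt; apply/negP => ai.
(* An eigenvalue of [2 *: A] of modulus above 1 drives the traces of even powers beyond [n], by
   Bernoulli's inequality. *)
pose x := (2 * a 0 i) ^+ 2 - 1.
have x0 : 0 < x.
  rewrite /x exprMn -(real_normK (num_real (a 0 i))); nra.
have [k hk] : exists k : nat, n%:R < k%:R * x.
  exists (Num.truncn (n%:R / x)).+1; rewrite -ltr_pdivrMr//.
  exact: truncnS_gt.
have := h k; rewrite E leNgt => /negP; apply.
apply: lt_le_trans hk _; rewrite (bigD1 i)//= -[leLHS]addr0; apply: lerD.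
  have -> : (2 * a 0 i) ^+ 2 = 1 + x by rewrite /x addrC subrK.
  apply: le_trans (bernoulli_ineq k (ltW x0)); lra.
by apply: sumr_ge0 => j _; rewrite exprn_ge0// sqr_ge0.
Qed.

Lemma measurable_specnorm_half (d : measure_display) (T : measurableType d)
  (A : T -> 'M[R]_n) : measurable_mx A -> (forall x, (A x)^T = A x) -> (0 < n)%N ->
  measurable [set x | specnorm (A x) <= 2^-1].
Proof.
move=> mA sA n0.
have -> : [set x | specnorm (A x) <= 2^-1] =
    \bigcap_k [set x | \tr (iter (2 * k) (mulmx (2 *: A x)) 1%:M) <= n%:R].
  by apply/seteqP; split => x /= h; [move=> k _; exact: (specnorm_half_powers (sA x) n0).1|
    apply/(specnorm_half_powers (sA x) n0) => k; exact: h].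
apply: bigcap_measurableType => k _.
rewrite -[X in measurable X]setTI; apply: measurable_fun_le => //.
exact/measurable_mxtrace/measurable_mx_iter/measurable_mx_scale.
Qed.
End SpectralNorm.

(** The exponent [theta'] of the lower tail: minus the value of [expR lam - 1 - lam / 2] at
    [lam = - ln 2]. *)
Definition theta_low {R : realType} : R := (1 - ln 2) / 2.

Section Tail.
Context (R : realType) (dO : measure_display) (Omega : measurableType dO)
  (P : probability Omega R).

Lemma markov_set (f : Omega -> R) (A : set Omega) (e B : R) : measurable A ->
  (forall w, 0 <= f w) -> 0 < e -> (forall w, A w -> e <= f w) ->
  (\int[P]_w (f w)%:E <= B%:E)%E -> (P A <= (B / e)%:E)%E.
Proof.
move=> mA f0 e0 ef fB; rewrite EFinM lee_pdivlMr// muleC; apply: le_trans fB.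
have -> : (e%:E * P A = \int[P]_w (e%:E * (\1_A w)%:E))%E.
  rewrite ge0_integralZl ?integral_indic ?setIT// ?lee_fin ?ltW//.
  exact/measurable_EFinP/measurable_indic.
apply: ge0_le_integralW => w; rewrite -EFinM lee_fin indicE; first by rewrite mulr_ge0// ltW.
by have [wA|wA] := boolP (w \in A); rewrite ?mulr1 ?mulr0//; apply: ef; rewrite inE in wA.
Qed.

Lemma mxtrace_expm_scale_ge (n : nat) (U : 'M[R]_n) (a : 'rV[R]_n) (lam : R) i : orth U ->
  expR (lam * a 0 i) <= \tr (expm (lam *: smx U a)).
Proof.
move=> oU; rewrite -smxZ expm_smx// mxtrace_smx// (bigD1 i)//= !mxE lerDl.
by apply: sumr_ge0 => j _; rewrite !mxE expR_ge0.
Qed.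

Lemma chernoff_specnorm (n : nat) (S : Omega -> 'M[R]_n) (t : R) :
  measurable_mx S -> (forall w, (S w)^T = S w) -> (0 < n)%N -> 0 < t ->
  (forall lam : R, (\int[P]_w (\tr (expm (lam *: S w)))%:E
      <= (n%:R * expR ((expR lam - 1) * t))%:E)%E) ->
  (P [set w | ~ (specnorm (t^-1 *: S w - 1%:M) <= 2^-1)%R] <=
     (n%:R * expR (- theta * t) + n%:R * expR (- theta_low * t))%:E)%E.
Proof.
move=> mS sS n0 t0 hS.
have sS' (c : R) w : (c *: S w)^T = c *: S w by rewrite linearZ /= sS.
have mtr (c : R) : measurable_fun setT (fun w => \tr (expm (c *: S w))).
  by apply: measurable_mxtrace_expm => //; exact: measurable_mx_scale.
pose A (c e : R) := [set w | expR (c * e) <= \tr (expm (c *: S w))].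
have mA c e : measurable (A c e).
  by rewrite -[X in measurable X]setTI; apply: measurable_fun_le.
have PA c e : (P (A c e) <= (n%:R * expR ((expR c - 1) * t - c * e))%:E)%E.
  have -> : n%:R * expR ((expR c - 1) * t - c * e) = n%:R * expR ((expR c - 1) * t) / expR (c * e).
    by rewrite expRD expRN mulrA.
  by apply: markov_set (mA c e) _ (expR_gt0 _) _ (hS c) => // w; exact: mxtrace_expm_ge0.
(* For the threshold [e] the exponent [(expR c - 1) * t - c * e] is least at [expR c = e / t], that
   is at 3/2 and 1/2. *)
pose A1 := A (ln (3 / 2)) (3 / 2 * t); pose A2 := A (- ln 2) (t / 2).
have sub : [set w | ~ (specnorm (t^-1 *: S w - 1%:M) <= 2^-1)%R] `<=` A1 `|` A2.
  move=> w /=; have [U [a oU ES]] := smxP (sS w); rewrite ES.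
  have -> : t^-1 *: smx U a - 1%:M = smx U (t^-1 *: a - const_mx 1).
    by rewrite -(smx1 oU) -smxZ -[- smx _ _]scaleN1r -[- const_mx 1]scaleN1r smxD smxZ smxZ.
  move=> /(specnorm_smx_leP _ oU n0) => /(_ (ltac:(by rewrite invr_ge0))).
  move=> /existsNP[i /negP]; rewrite -ltNge !mxE => hi.
  have t1 : t^-1 * a 0 i = a 0 i / t by rewrite mulrC.
  have [h|h] : 3 / 2 * t <= a 0 i \/ a 0 i <= t / 2.
    have [h|h] := leP (3 / 2 * t) (a 0 i); first by left.
    have [h'|h'] := leP (a 0 i) (t / 2); first by right.
    exfalso; move: hi; apply/negP; rewrite -leNgt t1 ler_norml.
    have u : a 0 i / t < 3 / 2 by rewrite ltr_pdivrMr.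
    have v : 1 / 2 < a 0 i / t by rewrite ltr_pdivlMr//; lra.
    by apply/andP; split; lra.
  - left; change (expR (ln (3 / 2) * (3 / 2 * t)) <= \tr (expm (ln (3 / 2) *: S w))).
    rewrite ES; apply: le_trans (mxtrace_expm_scale_ge a (ln (3 / 2)) i oU).
    by rewrite ler_expR ler_wpM2l// ln_ge0//; lra.
  - right; change (expR (- ln 2 * (t / 2)) <= \tr (expm (- ln 2 *: S w))).
    rewrite ES; apply: le_trans (mxtrace_expm_scale_ge a (- ln 2) i oU).
    by rewrite ler_expR ler_wnM2l// oppr_le0 ln_ge0//; lra.
have mbad : measurable [set w | ~ (specnorm (t^-1 *: S w - 1%:M) <= 2^-1)%R].
  apply: measurableC; apply: measurable_specnorm_half => //.
    apply: measurable_mx_add; first exact: measurable_mx_scale.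
    exact: measurable_mx_cst.
  by move=> w; rewrite linearB linearZ /= trmx1 sS.
have mU : measurable (A1 `|` A2) by apply: measurableU; exact: mA.
apply: le_trans (le_measure P (mem_set mbad) (mem_set mU) sub) _.
apply: le_trans (measureU2 _ (mA _ _) (mA _ _)) _; rewrite EFinD; apply: leeD.
  apply: le_trans (PA _ _) _; rewrite lee_fin ler_wpM2l// ler_expR lnK ?posrE//.
  by rewrite /theta; lra.
apply: le_trans (PA _ _) _; rewrite lee_fin ler_wpM2l// ler_expR expRN lnK ?posrE//.
by rewrite /theta_low; lra.
Qed.
End Tail.

(** * Bounds for the zeta function and for the two Chernoff exponents *)

Section ZetaEstimates.
Context (R : realType).
Implicit Types s p x y sigma : R.

(** The convex function $y \mapsto y^{-\sigma}$ lies above its tangent at [x]. Between consecutive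
    integers this gives telescoping bounds in place of the integral test. *)
Lemma powR_neg_tangent x y sigma : 0 < x -> 0 < y -> 0 <= sigma ->
  x `^ (- sigma) - y `^ (- sigma) <= sigma * x `^ (- (sigma + 1)) * (y - x).
Proof.
move=> x0 y0 s0.
have px r : x `^ r = expR (r * ln x) by rewrite /powR gt_eqF.
have py r : y `^ r = expR (r * ln y) by rewrite /powR gt_eqF.
have E : x `^ (- (sigma + 1)) = x `^ (- sigma) / x.
  by rewrite !px opprD mulrDl expRD mulN1r expRN lnK ?posrE.
have Ey : y `^ (- sigma) = x `^ (- sigma) * expR (- sigma * (ln y - ln x)).
  by rewrite px py -expRD; congr expR; ring.
have hl : ln y - ln x <= y / x - 1.
  by have := expR_ge1Dx (ln y - ln x); rewrite expRD expRN !lnK ?posrE//; lra.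
have h := expR_ge1Dx (- sigma * (ln y - ln x)).
rewrite Ey E; have -> : sigma * (x `^ (- sigma) / x) * (y - x) =
  x `^ (- sigma) * (sigma * (y / x - 1)) by field; rewrite gt_eqF.
rewrite -[X in X - _]mulr1 -mulrBr ler_wpM2l ?powR_ge0//.
have : sigma * (ln y - ln x) <= sigma * (y / x - 1) by rewrite ler_wpM2l.
move: h; lra.
Qed.

Lemma powR1n r : (1%:R : R) `^ r = 1.
Proof. by rewrite powR1. Qed.

Lemma sum_powR_upper p N : 1 < p ->
  \sum_(2 <= k < N) (k%:R : R) `^ (- p) <= (p - 1)^-1.
Proof.
move=> p1; have s0 : 0 < p - 1 by lra.
suff h M : \sum_(2 <= k < M.+2) (k%:R : R) `^ (- p) <=
    (p - 1)^-1 * (1 - (M.+1%:R : R) `^ (- (p - 1))).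
  have [N2|N2] := leqP N 2; first by rewrite big_geq// invr_ge0 ltW.
  case: N N2 => [|[|M]]// _; apply: le_trans (h M) _.
  by rewrite -[leRHS]mulr1 ler_pM2l ?invr_gt0// gerBl powR_ge0.
elim: M => [|M IH]; first by rewrite big_geq// powR1n subrr mulr0.
rewrite big_nat_recr//=; apply: le_trans (lerD IH (lexx _)) _.
have := @powR_neg_tangent M.+2%:R M.+1%:R (p - 1) (ltr0Sn _ _) (ltr0Sn _ _) (ltW s0).
rewrite subrK; have -> : M.+1%:R - M.+2%:R = -1 :> R by rewrite -(natr1 M.+1); ring.
move: (M.+2%:R `^ (- (p - 1))) (M.+1%:R `^ (- (p - 1))) (M.+2%:R `^ (- p)) => v u w h.
have : w <= (p - 1)^-1 * (u - v) by rewrite ler_pdivlMl//; lra.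
by rewrite !mulrBr; lra.
Qed.

Lemma sum_powR_lower s N : 1 < s ->
  (s - 1)^-1 * (1 - (N.+1%:R : R) `^ (- (s - 1))) <= \sum_(1 <= k < N.+1) (k%:R : R) `^ (- s).
Proof.
move=> s1; have s0 : 0 < s - 1 by lra.
elim: N => [|N IH]; first by rewrite big_geq// powR1n subrr mulr0.
rewrite big_nat_recr//=; apply: le_trans (lerD IH (lexx _)).
have := @powR_neg_tangent N.+1%:R N.+2%:R (s - 1) (ltr0Sn _ _) (ltr0Sn _ _) (ltW s0).
rewrite subrK; have -> : N.+2%:R - N.+1%:R = 1 :> R by rewrite -(natr1 N.+1); ring.
move: (N.+1%:R `^ (- (s - 1))) (N.+2%:R `^ (- (s - 1))) (N.+1%:R `^ (- s)) => u v w h.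
have : (s - 1)^-1 * (u - v) <= w by rewrite ler_pdivrMl//; lra.
by rewrite !mulrBr; lra.
Qed.

Lemma sum_powR_le_zeta s N : 1 < s -> \sum_(1 <= k < N) (k%:R : R) `^ (- s) <= zeta s.
Proof.
move=> s1; pose u N := \sum_(1 <= k < N) (k%:R : R) `^ (- s).
have ndu : nondecreasing_seq u.
  apply/nondecreasing_seqP => m; rewrite /u; case: m => [|m]; first by rewrite !big_geq.
  by rewrite [leRHS]big_nat_recr//= lerDl powR_ge0.
apply: (nondecreasing_cvgn_le ndu); apply: nondecreasing_is_cvgn => //.
exists (1 + (s - 1)^-1) => _ [m _ <-]; rewrite /u.
have [m1|m1] := leqP m 1; first by rewrite big_geq// addr_ge0// invr_ge0; lra.
by rewrite big_ltn// powR1n lerD2l; exact: sum_powR_upper.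
Qed.

Lemma zeta_ge1 s : 1 < s -> 1 <= zeta s.
Proof. by move=> s1; have := sum_powR_le_zeta 2 s1; rewrite big_nat1 powR1n. Qed.

(** In fact $\zeta(s) \ge 1/(s-1)$. A finite partial sum already reaches 4: [N] is taken so large
    that the defect [(N+1)^(-(s-1))] is at most [1 - 4 (s-1)]. *)
Lemma zeta_ge4 s : 1 < s -> s < 5 / 4 -> 4 <= zeta s.
Proof.
move=> s1 s54; pose x := 1 - 4 * (s - 1); have x0 : 0 < x by rewrite /x; lra.
pose N := Num.truncn (expR (- ln x / (s - 1))).
have hN : expR (- ln x / (s - 1)) < N.+1%:R by exact: truncnS_gt.
have h : (N.+1%:R : R) `^ (- (s - 1)) <= x.
  rewrite /powR pnatr_eq0 /= -[leRHS]lnK ?posrE// ler_expR mulNr lerNl mulrC -ler_pdivrMr; last lra.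
  by rewrite -ler_expR lnK ?posrE// ltW.
apply: le_trans (sum_powR_le_zeta N.+1 s1); apply: le_trans (sum_powR_lower N s1).
by rewrite ler_pdivlMl; [move: h; rewrite /x; lra|lra].
Qed.

(** This amounts to $\ln (3/2) > 1/3$, which follows from $\exp (-1/3) > 1 - 1/3$. *)
Lemma theta_gt0 : 0 < theta :> R.
Proof.
have h : 1 + (- 3^-1) < expR (- 3^-1) :> R by apply: expR_gt1Dx; rewrite oppr_eq0 invr_eq0 pnatr_eq0.
have : 3^-1 < ln (3 / 2) :> R.
  rewrite -ltr_expR lnK ?posrE; last lra.
  have : (1 - 3^-1) * expR 3^-1 < 1 :> R.
    by rewrite -ltr_pdivlMr ?expR_gt0// div1r -expRN.
  lra.
rewrite /theta; lra.
Qed.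

Lemma expR_ge_series (x : R) N : 0 <= x -> \sum_(0 <= k < N) x ^+ k / k`!%:R <= expR x.
Proof.
move=> x0; have nd : nondecreasing_seq (series (exp_coeff x)).
  apply/nondecreasing_seqP => m; rewrite /series /= big_nat_recr//= lerDl /exp_coeff.
  by rewrite /= divr_ge0// exprn_ge0.
exact: (nondecreasing_cvgn_le nd (is_cvg_series_exp_coeff x)).
Qed.

(** Clearing denominators leaves $4 \ln (3/2) + \ln 2 \le 7/3$, that is $81/8 \le \exp (7/3)$; seven
    terms of the exponential series suffice. *)
Lemma theta_low_ge : 4 / 3 * theta <= theta_low :> R.
Proof.
have h : ln (81 / 8) <= 7 / 3 :> R.
  rewrite -ler_expR lnK ?posrE; last lra.
  apply: le_trans (@expR_ge_series (7 / 3) 7 _); last lra.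
  by rewrite unlock /=; rewrite !factS fact0 /=; lra.
have E : ln (81 / 8) = 4 * ln (3 / 2) + ln 2 :> R.
  have -> : 81 / 8 = (3 / 2) ^+ 4 * 2 :> R by lra.
  by rewrite lnM ?posrE ?exprn_gt0// ?lnXn; lra.
by rewrite /theta /theta_low; lra.
Qed.
End ZetaEstimates.

(** * Failure probability per level and its sum over the levels *)

Section SampleCount.
Context (R : realType) (s alpha : R).
Hypotheses (alpha01 : 0 < alpha < 1) (s1 : 1 < s).

Definition bound_arg (n : nat) : R := zeta s * (n%:R `^ (s + 1)) / alpha.

Let a0 : 0 < alpha. Proof. by case/andP: alpha01. Qed.
Let a1 : alpha < 1. Proof. by case/andP: alpha01. Qed.
Let z1 : 1 <= zeta s. Proof. exact: zeta_ge1. Qed.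
Let z0 : 0 < zeta s. Proof. exact: lt_le_trans ltr01 z1. Qed.

Lemma powR_nat (n : nat) (r : R) : (0 < n)%N -> (n%:R : R) `^ r = expR (r * ln n%:R).
Proof. by move=> n0; rewrite /powR pnatr_eq0 gtn_eqF. Qed.

Lemma ln_bound_arg n : (0 < n)%N ->
  ln (bound_arg n) = ln (zeta s) + (s + 1) * ln n%:R - ln alpha.
Proof.
move=> n0; rewrite /bound_arg ln_div ?posrE// ?mulr_gt0 ?powR_gt0 ?ltr0n//.
by rewrite lnM ?posrE ?powR_gt0 ?ltr0n// powR_nat// expRK.
Qed.

Lemma ln_nat_ge0 n : (0 < n)%N -> 0 <= ln (n%:R : R).
Proof. by move=> n0; rewrite ln_ge0// ler1n. Qed.

Lemma ln_bound_arg_gt0 n : (0 < n)%N -> 0 < ln (bound_arg n).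
Proof.
move=> n0; rewrite ln_bound_arg//.
have h1 : 0 <= ln (zeta s) by exact: ln_ge0.
have h2 : 0 <= (s + 1) * ln (n%:R : R) by rewrite mulr_ge0 ?ln_nat_ge0//; move: s1; lra.
have h3 : ln alpha < 0 by rewrite ln_lt0// a0 a1.
lra.
Qed.

Lemma tau_ge n : (0 < n)%N -> theta^-1 * ln (bound_arg n) <= (tau s alpha n)%:R.
Proof.
move=> n0; rewrite /tau -/(bound_arg n); set x := _^-1 * _.
have x0 : 0 < x by rewrite mulr_gt0 ?invr_gt0 ?theta_gt0 ?ln_bound_arg_gt0.
have c0 : (0 <= Num.ceil x)%R by rewrite -(ceil0 R) ceil_le// ltW.
by rewrite natr_absz ger0_norm// ceil_ge.
Qed.

Lemma tau_gt0 n : (0 < n)%N -> (0 < tau s alpha n)%N.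
Proof.
move=> n0; rewrite -(ltr_nat R); apply: lt_le_trans (tau_ge n0).
by rewrite mulr_gt0 ?invr_gt0 ?theta_gt0 ?ln_bound_arg_gt0.
Qed.

Lemma tau_le m n : (0 < m)%N -> (m <= n)%N -> (tau s alpha m <= tau s alpha n)%N.
Proof.
move=> m0 mn; have n0 : (0 < n)%N by exact: leq_trans mn.
have h : ln (bound_arg m) <= ln (bound_arg n).
  rewrite !ln_bound_arg// lerD2r lerD2l ler_wpM2l//; first by move: s1; lra.
  by rewrite ler_ln ?posrE ?ltr0n// ler_nat.
have h' : theta^-1 * ln (bound_arg m) <= theta^-1 * ln (bound_arg n).
  by rewrite ler_wpM2l// invr_ge0 ltW// theta_gt0.
have c0 : (0 <= Num.ceil (theta^-1 * ln (bound_arg m)))%R.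
  by rewrite -(ceil0 R) ceil_le// mulr_ge0 ?invr_ge0 ?ltW ?theta_gt0 ?ln_bound_arg_gt0.
rewrite /tau -!/(bound_arg _) -lez_nat !gez0_abs//; first exact: ceil_le.
by apply: le_trans c0 _; exact: ceil_le.
Qed.

(** The first term is the upper tail at the prescribed number of samples. The second is the lower
    tail, smaller by [exp (- theta tau / 3)], which is at most $(\zeta n^{s+1} / \alpha)^{-1/3}$;
    the factor $\alpha^{1/3} \le 1$ is dropped. *)
Definition fail_bound (n : nat) : R := if n == 1 then 0 else
  alpha / zeta s * (n%:R `^ (- s) + zeta s `^ (- 3^-1) * n%:R `^ (- (s + (s + 1) / 3))).

Lemma fail_bound_ge0 n : 0 <= fail_bound n.
Proof.
rewrite /fail_bound; case: ifP => // _; apply: mulr_ge0.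
  by apply: divr_ge0; apply: ltW.
by rewrite addr_ge0 ?mulr_ge0 ?powR_ge0.
Qed.

Lemma chernoff_le_fail_bound n : (1 < n)%N ->
  n%:R * expR (- theta * (tau s alpha n)%:R) + n%:R * expR (- theta_low * (tau s alpha n)%:R)
  <= fail_bound n.
Proof.
move=> n1; have n0 : (0 < n)%N by exact: ltnW.
rewrite /fail_bound gtn_eqF//; set t := (tau s alpha n)%:R.
have t0 : 0 <= t by rewrite /t ler0n.
have ht : ln (bound_arg n) <= theta * t.
  by rewrite -ler_pdivrMl ?theta_gt0// tau_ge.
have nE : n%:R = expR (ln n%:R) :> R by rewrite lnK ?posrE ?ltr0n.
have e1 : n%:R * expR (- theta * t) <= alpha / zeta s * n%:R `^ (- s).
  have -> : alpha / zeta s * n%:R `^ (- s) = n%:R * expR (- ln (bound_arg n)).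
    rewrite ln_bound_arg// powR_nat// -[X in X / _]lnK ?posrE// -[X in _ / X]lnK ?posrE//.
    by rewrite nE -expRN -!expRD -nE; congr expR; lra.
  by rewrite ler_pM2l ?ltr0n// ler_expR; lra.
have e2 : expR (- (theta * t / 3)) <= zeta s `^ (- 3^-1) * n%:R `^ (- ((s + 1) / 3)).
  rewrite powR_nat// /powR gt_eqF//= -expRD ler_expR; move: ht; rewrite ln_bound_arg//.
  have h3 : ln alpha < 0 by rewrite ln_lt0// a0 a1.
  lra.
have e3 : n%:R * expR (- theta_low * t) <=
    alpha / zeta s * (zeta s `^ (- 3^-1) * n%:R `^ (- (s + (s + 1) / 3))).
  apply: (@le_trans _ _ ((n%:R * expR (- theta * t)) * expR (- (theta * t / 3)))).
    rewrite -mulrA -expRD ler_pM2l ?ltr0n// ler_expR.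
    have := ler_wpM2r t0 (@theta_low_ge R); lra.
  apply: (@le_trans _ _ ((alpha / zeta s * n%:R `^ (- s)) *
     (zeta s `^ (- 3^-1) * n%:R `^ (- ((s + 1) / 3))))).
    by apply: ler_pM => //; rewrite ?mulr_ge0 ?expR_ge0.
  rewrite le_eqVlt; apply/orP; left; apply/eqP.
  rewrite opprD (powRD _ (x := n%:R)); first by ring.
  by rewrite pnatr_eq0 -lt0n n0 implybT.
by rewrite mulrDr; exact: lerD.
Qed.

Lemma sum_fail_bound N : \sum_(1 <= m < N) fail_bound m <= alpha.
Proof.
have [N1|N1] := leqP N 1; first by rewrite big_geq// ltW.
rewrite big_ltn// {1}/fail_bound eqxx add0r.
have -> : \sum_(2 <= m < N) fail_bound m = alpha / zeta s *
    (\sum_(2 <= m < N) m%:R `^ (- s) +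
     zeta s `^ (- 3^-1) * \sum_(2 <= m < N) m%:R `^ (- (s + (s + 1) / 3))).
  rewrite mulr_sumr -big_split mulr_sumr /= !big_nat; apply: eq_bigr => m /andP[m2 _].
  by rewrite /fail_bound gtn_eqF.
have h1 : \sum_(2 <= m < N) (m%:R : R) `^ (- s) <= zeta s - 1.
  by have := sum_powR_le_zeta N s1; rewrite big_ltn// powR1n; lra.
have p1 : 1 < s + (s + 1) / 3 by move: s1; lra.
have h2 := sum_powR_upper N p1; set p := s + (s + 1) / 3 in p1 h2 *.
(* Here [p - 1 = (4 s - 2) / 3]. It is at least 1 for [s >= 5/4]; below, it still exceeds 2/3, and
   [zeta s >= 4 > (3/2)^3] bounds the left side by 2/3. *)
have zp : zeta s `^ (- 3^-1) <= p - 1.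
  have [s54|s54] := leP (5 / 4) s.
    apply: (@le_trans _ _ 1); last by rewrite /p; move: s1; lra.
    rewrite /powR gt_eqF// -expR0 ler_expR mulNr oppr_le0 mulr_ge0 ?invr_ge0//.
    exact: ln_ge0.
  have z4 := zeta_ge4 s1 s54.
  apply: (@le_trans _ _ (2 / 3)); last by rewrite /p; move: s1; lra.
  rewrite /powR gt_eqF//.
  have -> : 2 / 3 = expR (- ln (3 / 2)) :> R.
    by rewrite expRN lnK ?posrE; lra.
  rewrite ler_expR mulNr lerN2 [leRHS]mulrC ler_pdivlMr//.
  have -> : ln (3 / 2) * 3 = ln ((3 / 2) ^+ 3) :> R by rewrite lnXn ?mulr_natr//; lra.
  by rewrite ler_ln ?posrE ?exprn_gt0//; lra.
have h3 : zeta s `^ (- 3^-1) * \sum_(2 <= m < N) (m%:R : R) `^ (- p) <= 1.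
  apply: (@le_trans _ _ ((p - 1) * (p - 1)^-1)); last by rewrite divff//; lra.
  apply: ler_pM => //; first exact: powR_ge0.
  by apply: sumr_ge0 => m _; exact: powR_ge0.
rewrite -[leRHS](divfK (x := zeta s)) ?gt_eqF//; apply: ler_wpM2l.
  by rewrite divr_ge0// ltW.
lra.
Qed.
End SampleCount.

(** The dimensions are distinct, so a sum over levels is dominated by the sum over all integers;
    this is why the bound does not depend on [K]. *)
Lemma sum_increasing_le (R : realType) (f : nat -> R) (n : nat -> nat) (K : nat) :
  (forall m, 0 <= f m) -> (0 < n 0)%N -> (forall k, (k < K)%N -> (n k < n k.+1)%N) ->
  \sum_(k < K.+1) f (n k) <= \sum_(1 <= m < (n K).+1) f m.
Proof.
move=> f0 n0; elim: K => [|K IH] nK.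
  rewrite big_ord_recl big_ord0 addr0 big_nat_recr//= lerDr.
  by apply: sumr_ge0.
rewrite big_ord_recr /= [leRHS]big_nat_recr /=; last exact: leq_trans (nK K _).
rewrite lerD2r; apply: le_trans (IH _) _; first by move=> k kK; apply: nK; exact: ltnW.
rewrite [leRHS](@big_cat_nat _ _ _ (n K).+1)//=; last exact: nK.
by rewrite lerDl; apply: sumr_ge0.
Qed.

(** * Square integrable functions and Fourier coefficients *)

Section SquareIntegrable.
Context (R : realType) (d : measure_display) (T : measurableType d) (rho : probability T R).
Implicit Types f g u r : T -> R.

Lemma L2_sqr_integrable f : L2 rho f -> rho.-integrable setT (EFin \o (fun x => f x ^+ 2)).
Proof.
move=> [mf f2]; apply/integrableP; split.
  by apply/measurable_EFinP; exact: measurable_funX.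
by under eq_integral do rewrite /= ger0_norm ?sqr_ge0//.
Qed.

Lemma integrable_dominated f g : measurable_fun setT f ->
  rho.-integrable setT (EFin \o g) -> (forall x, `|f x| <= g x) ->
  rho.-integrable setT (EFin \o f).
Proof.
move=> mf ig fg; apply: le_integrable ig => //; first exact/measurable_EFinP.
by move=> x _ /=; rewrite lee_fin; apply: le_trans (fg x) _; exact: ler_norm.
Qed.

Lemma L2M_integrable f g : L2 rho f -> L2 rho g ->
  rho.-integrable setT (EFin \o (fun x => f x * g x)).
Proof.
move=> hf hg; have := integrable_addR (L2_sqr_integrable hf) (L2_sqr_integrable hg).
move=> ig; apply: (integrable_dominated _ ig); first by apply: measurable_funM; [case: hf|case: hg].
move=> x; rewrite ler_norml; apply/andP; split; nra.
Qed.

Lemma L2_of_integrable f : measurable_fun setT f ->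
  rho.-integrable setT (EFin \o (fun x => f x ^+ 2)) -> L2 rho f.
Proof.
move=> mf /integrableP[_ h]; split => //; move: h.
by under eq_integral do rewrite /= ger0_norm ?sqr_ge0//.
Qed.

Lemma L2D f g : L2 rho f -> L2 rho g -> L2 rho (fun x => f x + g x).
Proof.
move=> hf hg; apply: L2_of_integrable.
  by apply: measurable_funD; [case: hf|case: hg].
have := integrable_scaleR 2 (integrable_addR (L2_sqr_integrable hf) (L2_sqr_integrable hg)).
move=> ig; apply: (integrable_dominated _ ig).
  by apply: measurable_funX; apply: measurable_funD; [case: hf|case: hg].
by move=> x; rewrite ger0_norm ?sqr_ge0//; have := sqr_ge0 (f x - g x); nra.
Qed.

Lemma L2Z (c : R) f : L2 rho f -> L2 rho (fun x => c * f x).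
Proof.
move=> hf; apply: L2_of_integrable.
  by apply: measurable_funM; [exact: measurable_cst|case: hf].
rewrite (_ : (fun x => (c * f x) ^+ 2) = fun x => c ^+ 2 * f x ^+ 2); last first.
  by apply/funext => x; rewrite exprMn.
exact: integrable_scaleR (L2_sqr_integrable hf).
Qed.

Lemma L2_sum (I : Type) (s : seq I) (F : I -> T -> R) : (forall i, L2 rho (F i)) ->
  L2 rho (fun x => \sum_(i <- s) F i x).
Proof.
move=> hF; elim: s => [|i s IH].
  under eq_fun do rewrite big_nil; split; first exact: measurable_cst.
  by under eq_integral do rewrite expr0n; rewrite integral0 ltry.
by under eq_fun do rewrite big_cons; exact: L2D.
Qed.

Lemma L2_integralE f : L2 rho f ->
  (\int[rho]_x (f x ^+ 2)%:E = (\int[rho]_x (f x ^+ 2)%R)%:E)%E.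
Proof. by move=> hf; rewrite fineK// integrable_fin_num// L2_sqr_integrable. Qed.

Lemma ONB_L2 psi i : ONB rho psi -> L2 rho (psi i).
Proof.
move=> [mpsi orth _]; split; first exact: mpsi.
by under eq_integral do rewrite expr2; rewrite orth eqxx ltry.
Qed.

Lemma ONB_Rintegral psi i j : ONB rho psi ->
  \int[rho]_x (psi i x * psi j x) = (i == j)%:R.
Proof. by move=> [_ orth _]; rewrite /Rintegral orth. Qed.

Lemma spanf_L2 psi n c : ONB rho psi -> L2 rho (spanf psi n c).
Proof. by move=> h; apply: L2_sum => i; apply: L2Z; exact: ONB_L2. Qed.

Definition fourier (psi : nat -> T -> R) (u : T -> R) (i : nat) : R :=
  \int[rho]_x (u x * psi i x).

Definition residual (psi : nat -> T -> R) (n : nat) (u : T -> R) (x : T) : R :=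
  u x - spanf psi n (fourier psi u) x.

Lemma residual_L2 psi n u : ONB rho psi -> L2 rho u -> L2 rho (residual psi n u).
Proof.
move=> hpsi hu; have := L2D hu (L2Z (-1) (spanf_L2 n (fourier psi u) hpsi)).
by under eq_fun do rewrite mulN1r.
Qed.

Lemma Rintegral_spanf_mul psi n c p : ONB rho psi -> (p < n)%N ->
  \int[rho]_x (spanf psi n c x * psi p x) = c p.
Proof.
move=> hpsi pn.
have i1 (i : 'I_n) : rho.-integrable setT (EFin \o (fun x => c i * (psi i x * psi p x))).
  by apply: integrable_scaleR; apply: L2M_integrable; exact: ONB_L2.
transitivity (\int[rho]_x (\sum_(i < n) c i * (psi i x * psi p x))).
  by apply: eq_Rintegral => x _; rewrite mulr_suml; apply: eq_bigr => i _; rewrite mulrA.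
rewrite (Rintegral_sum _ i1).2.
transitivity (\sum_(i < n) c i * (i == p :> nat)%:R).
  apply: eq_bigr => i _; rewrite RintegralZl//; first by rewrite ONB_Rintegral.
  by apply: L2M_integrable; exact: ONB_L2.
rewrite (bigD1 (Ordinal pn))//= eqxx mulr1 big1 ?addr0// => i ip.
by rewrite (_ : (i == p :> nat) = false) ?mulr0//; apply/negbTE; exact: ip.
Qed.

Lemma residual_ortho psi n u p : ONB rho psi -> L2 rho u -> (p < n)%N ->
  \int[rho]_x (residual psi n u x * psi p x) = 0.
Proof.
move=> hpsi hu pn.
transitivity (\int[rho]_x (u x * psi p x - spanf psi n (fourier psi u) x * psi p x)).
  by apply: eq_Rintegral => x _; rewrite mulrBl.
rewrite RintegralB//; first by rewrite Rintegral_spanf_mul// subrr.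
  by apply: L2M_integrable => //; exact: ONB_L2.
by apply: L2M_integrable; [exact: spanf_L2|exact: ONB_L2].
Qed.

(** Used twice: it bounds the best approximation error below by the residual, and it splits the
    error of the estimator into residual and coefficient error. *)
Lemma pythagoras psi n u c : ONB rho psi -> L2 rho u ->
  \int[rho]_x ((u x - spanf psi n c x) ^+ 2) =
  \int[rho]_x (residual psi n u x ^+ 2) + \sum_(i < n) (c i - fourier psi u i) ^+ 2.
Proof.
move=> hpsi hu; pose e i := c i - fourier psi u i.
pose r := residual psi n u.
have hr : L2 rho r by exact: residual_L2.
have he : L2 rho (spanf psi n e) by exact: spanf_L2.
have E x : u x - spanf psi n c x = r x - spanf psi n e x.
  rewrite /r /residual -addrA; congr (_ + _); rewrite -opprD; congr (- _).
  by rewrite /spanf -big_split; apply: eq_bigr => i _ /=; rewrite /e -mulrDl addrC subrK.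
transitivity (\int[rho]_x (r x ^+ 2 + (spanf psi n e x * spanf psi n e x + (-2) * (r x * spanf psi n e x)))).
  by apply: eq_Rintegral => x _; rewrite E; ring.
have i1 := L2_sqr_integrable hr; have i2 := L2M_integrable he he.
have i3 := L2M_integrable hr he; have i4 := integrable_scaleR (-2) i3.
rewrite RintegralD//; last exact: integrable_addR.
congr (_ + _); rewrite RintegralD// RintegralZl//.
have lin (f : T -> R) : L2 rho f -> \int[rho]_x (f x * spanf psi n e x) =
    \sum_(i < n) e i * \int[rho]_x (f x * psi i x).
  move=> hf.
  have j1 (i : 'I_n) : rho.-integrable setT (EFin \o (fun x => e i * (f x * psi i x))).
    by apply: integrable_scaleR; apply: L2M_integrable => //; exact: ONB_L2.
  transitivity (\int[rho]_x (\sum_(i < n) e i * (f x * psi i x))).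
    by apply: eq_Rintegral => x _; rewrite mulr_sumr; apply: eq_bigr => i _; rewrite mulrCA.
  rewrite (Rintegral_sum _ j1).2; apply: eq_bigr => i _; rewrite RintegralZl//.
  by apply: L2M_integrable => //; exact: ONB_L2.
rewrite !lin// [X in _ + _ * X]big1 => [|i _]; last by rewrite residual_ortho// mulr0.
by rewrite mulr0 addr0; apply: eq_bigr => i _; rewrite Rintegral_spanf_mul.
Qed.

Lemma err2_ge psi n u : ONB rho psi -> L2 rho u ->
  ((\int[rho]_x (residual psi n u x ^+ 2)%R)%:E <= err2 rho psi n u)%E.
Proof.
move=> hpsi hu; apply: le_ereal_inf_tmp => _ [c _ <-].
have hL : L2 rho (fun x => u x - spanf psi n c x).
  have := L2D hu (L2Z (-1) (spanf_L2 n c hpsi)).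
  by under eq_fun do rewrite mulN1r.
rewrite (L2_integralE hL) lee_fin pythagoras// lerDl.
by apply: sumr_ge0 => i _; exact: sqr_ge0.
Qed.
End SquareIntegrable.

(** The samples outside the subfamily get the trivial constraint [setT]. This is what lets a coarse
    level recycle part of the finest sample. *)
Lemma independent_inj (R : realType) (dO : measure_display) (Omega : measurableType dO)
  (P : probability Omega R) (d : measure_display) (T : measurableType d)
  (I J : finType) (X : I -> Omega -> T) (h : J -> I) : injective h ->
  independent P X -> independent P (fun j => X (h j)).
Proof.
move=> hinj indX A mA; pose A' i := if [pick j | h j == i] is Some j then A j else setT.
have A'h j : A' (h j) = A j.
  rewrite /A'; case: pickP => [j' /eqP/hinj -> //|/(_ j)]; by rewrite eqxx.
have mA' i : measurable (A' i) by rewrite /A'; case: pickP.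
have -> : \bigcap_(j in [set: J]) (X (h j) @^-1` A j) =
    cylinder X (map h (index_enum J)) A'.
  apply/seteqP; split => w hw.
    by move=> _ /mapP[j _ ->]; rewrite A'h; exact: hw.
  by move=> j _; rewrite -A'h; apply: hw; apply/mapP; exists j => //; exact: mem_index_enum.
rewrite (cylinder_prod indX) ?map_inj_uniq ?index_enum_uniq// big_map.
by congr (_%:E); apply: eq_bigr => j _; rewrite A'h.
Qed.

(** * Expectations under the sample laws and the rank-one projections *)

Section SampleLaw.
Context (R : realType) (d : measure_display) (T : measurableType d) (rho : probability T R)
  (psi : nat -> T -> R) (dO : measure_display) (Omega : measurableType dO)
  (P : probability Omega R) (Y : Omega -> T) (j : nat).
Hypotheses (mpsi : measurable_fun setT (psi j)) (mY : measurable_fun setT Y).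
Hypothesis lawY : forall A, measurable A -> P (Y @^-1` A) = chi rho psi j A.

Lemma sample_law_ge0 (f : T -> \bar R) : measurable_fun setT f -> (forall x, 0 <= f x)%E ->
  (\int[P]_w f (Y w) = \int[rho]_x (f x * (psi j x ^+ 2)%:E))%E.
Proof.
move=> mf f0.
pose Y' : {mfun Omega >-> T} := HB.pack Y (isMeasurableFun.Build _ _ _ _ _ mY).
rewrite -(@ge0_integral_distribution _ _ _ _ _ P Y')//.
apply: ge0_integral_density => //; first exact: measurable_funX.
by move=> x; exact: sqr_ge0.
Qed.

Lemma sample_law (f : T -> R) : measurable_fun setT f ->
  rho.-integrable setT (EFin \o (fun x => f x * psi j x ^+ 2)) ->
  P.-integrable setT (EFin \o (f \o Y)) /\
  \int[P]_w f (Y w) = \int[rho]_x (f x * psi j x ^+ 2).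
Proof.
move=> mf intf; split.
  apply/integrableP; split; first by apply/measurable_EFinP; exact: measurableT_comp.
  have := sample_law_ge0 (f := fun x => `|f x|%:E) => /= ->; last 2 first.
  - by apply/measurable_EFinP; exact: measurableT_comp.
  - by move=> x; rewrite lee_fin.
  move/integrableP: intf => [_]; apply: le_lt_trans; rewrite le_eqVlt; apply/orP; left.
  by apply/eqP/eq_integral => x _ /=; rewrite normrM (ger0_norm (sqr_ge0 _)) EFinM.
rewrite /Rintegral [in LHS]integralE [in RHS]integralE; congr (fine (_ - _)).
- transitivity (\int[P]_w (fun x => ((EFin \o f)^\+ x)%E) (Y w))%E.
    by apply: eq_integral => w _; rewrite !funeposE.
  rewrite sample_law_ge0; last 2 first.
  + by apply: measurable_funepos; exact/measurable_EFinP.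
  + by move=> x; exact: funepos_ge0.
  apply: eq_integral => x _; rewrite !funeposE /= -!EFin_max -EFinM.
  by rewrite maxr_pMl ?sqr_ge0// mul0r.
- transitivity (\int[P]_w (fun x => ((EFin \o f)^\- x)%E) (Y w))%E.
    by apply: eq_integral => w _; rewrite !funenegE.
  rewrite sample_law_ge0; last 2 first.
  + by apply: measurable_funeneg; exact/measurable_EFinP.
  + by move=> x; exact: funeneg_ge0.
  apply: eq_integral => x _; rewrite !funenegE /= -!EFin_max -EFinM.
  by rewrite maxr_pMl ?sqr_ge0// mul0r mulNr.
Qed.
End SampleLaw.

Section ProjectionMatrix.
Context (R : realType) (d : measure_display) (T : measurableType d)
  (psi : nat -> T -> R) (n : nat).
Hypothesis psi_neq0 : forall x : T, exists2 i, (i < n)%N & psi i x != 0.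
Hypothesis mpsi : forall i, measurable_fun setT (psi i).

Definition sumsq (x : T) : R := \sum_(i < n) psi i x ^+ 2.

Lemma sumsq_gt0 x : 0 < sumsq x.
Proof.
have [i i_n pi0] := psi_neq0 x; rewrite /sumsq (bigD1 (Ordinal i_n))//=.
by rewrite ltr_pwDl ?exprn_even_gt0// sumr_ge0// => j _; exact: sqr_ge0.
Qed.

Lemma measurable_sumsq : measurable_fun setT sumsq.
Proof. by apply: measurable_sum => i; exact: measurable_funX. Qed.

Lemma measurable_sumsqV : measurable_fun setT (fun x => (sumsq x)^-1).
Proof.
have -> : (fun x => (sumsq x)^-1) = fun x => sumsq x `^ (-1).
  by apply/funext => x; rewrite powR_inv1// ltW// sumsq_gt0.
apply: (measurableT_comp (@measurable_powR R (-1))); exact: measurable_sumsq.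
Qed.

Definition projmx (x : T) : 'M[R]_n := \matrix_(p, q) (psi p x * psi q x * (sumsq x)^-1).

Lemma measurable_projmx : measurable_mx projmx.
Proof.
move=> p q; under eq_fun do rewrite mxE; apply: measurable_funM.
  exact: measurable_funM.
exact: measurable_sumsqV.
Qed.

Lemma projmx_proj x : is_proj (projmx x).
Proof.
split; apply/matrixP => p q; rewrite !mxE; first by rewrite [psi q x * _]mulrC.
have s0 := sumsq_gt0 x; set s := sumsq x in s0 *.
transitivity (\sum_(k < n) psi p x * psi q x * s^-1 ^+ 2 * psi k x ^+ 2).
  by apply: eq_bigr => k _; rewrite !mxE -/s; ring.
rewrite -mulr_sumr -/(sumsq x) -/s; field; exact: lt0r_neq0.
Qed.

(** The [n] in the weight cancels the [n] in the number of samples, leaving outer products divided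
    by their trace. *)
Lemma gram_projmx (t : nat) (x : nat -> nat -> T) : (0 < n)%N ->
  gram psi n t x = t%:R^-1 *: \sum_(i : 'I_n * 'I_t) projmx (x i.1 i.2).
Proof.
move=> n0; apply/matrixP => p q; rewrite !mxE summxE natrM invfM [X in X * _ = _]mulrC -mulrA.
congr (_ * _); rewrite -(pair_bigA _ (fun (j : 'I_n) (k : 'I_t) => projmx (x j k) p q)) /=.
rewrite mulr_sumr; apply: eq_bigr => j _; rewrite mulr_sumr; apply: eq_bigr => k _.
have s0 := sumsq_gt0 (x j k); rewrite mxE /weight -/(sumsq _).
by field; rewrite lt0r_neq0// pnatr_eq0 -lt0n n0.
Qed.
End ProjectionMatrix.

(** * Second moments of sums of independent variables *)

Section SecondMoment.
Context (R : realType) (dO : measure_display) (Omega : measurableType dO)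
  (P : probability Omega R).

Lemma L2_integrable (f : Omega -> R) : L2 P f -> P.-integrable setT (EFin \o f).
Proof.
move=> hf; have ig : P.-integrable setT (EFin \o (fun w => 1 + f w ^+ 2)).
  apply: integrable_addR (L2_sqr_integrable hf).
  exact: finite_measure_integrable_cst.
apply: (integrable_dominated _ ig); first by case: hf.
by move=> w; rewrite ler_norml; apply/andP; split; nra.
Qed.

(** The single means may be nonzero. Since they add up to zero, the cross terms of [i] sum to
    [- (E Z_i)^2], so the second moment of the sum is the sum of the variances. *)
Lemma uncorrelated_second_moment (J : finType) (Z : J -> Omega -> R) :
  (forall i, L2 P (Z i)) ->
  (forall i j, i != j -> \int[P]_w (Z i w * Z j w) = \int[P]_w Z i w * \int[P]_w Z j w) ->
  \sum_i \int[P]_w Z i w = 0 ->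
  \int[P]_w ((\sum_i Z i w) ^+ 2) <= \sum_i \int[P]_w (Z i w ^+ 2).
Proof.
move=> hZ unc Z0.
have i1 i j : P.-integrable setT (EFin \o (fun w => Z i w * Z j w)) by exact: L2M_integrable.
have i2 i := Rintegral_sum (index_enum J) (i1 i).
have i3 := Rintegral_sum (index_enum J) (fun i => (i2 i).1).
have -> : \int[P]_w ((\sum_i Z i w) ^+ 2) = \sum_i \sum_j \int[P]_w (Z i w * Z j w).
  transitivity (\int[P]_w (\sum_i \sum_j Z i w * Z j w)).
    apply: eq_Rintegral => w _; rewrite expr2 mulr_suml; apply: eq_bigr => i _.
    by rewrite mulr_sumr.
  by rewrite i3.2; apply: eq_bigr => i _; rewrite (i2 i).2.
have E i : \sum_j \int[P]_w (Z i w * Z j w) =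
    \int[P]_w (Z i w ^+ 2) - (\int[P]_w Z i w) ^+ 2.
  rewrite (bigD1 i)//=; congr (_ + _).
  have -> : \sum_(j | j != i) \int[P]_w (Z i w * Z j w) =
      \sum_(j | j != i) \int[P]_w Z i w * \int[P]_w Z j w.
    by apply: eq_bigr => j ji; rewrite unc// eq_sym.
  by move: Z0; rewrite -mulr_sumr (bigD1 i)//= => /eqP; rewrite addrC addr_eq0 => /eqP ->; ring.
apply: ler_sum => i _; rewrite E gerBl; exact: sqr_ge0.
Qed.

Context (d : measure_display) (T : measurableType d) (J : finType) (X : J -> Omega -> T).
Hypothesis mX : forall i, measurable_fun setT (X i).
Hypothesis indX : independent P X.

Lemma independent_pair i j A B : i != j -> measurable A -> measurable B ->
  P (X i @^-1` A `&` X j @^-1` B) = (P (X i @^-1` A) * P (X j @^-1` B))%E.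
Proof.
move=> ij mA mB; have u : uniq [:: i; j] by rewrite /= inE ij.
apply: (independent_rest mX indX u mA _).2; apply: sub_sigma_algebra.
exists (fun l => if l == j then B else setT); first by move=> l; case: ifP.
by apply: preimage_cylinder; rewrite inE.
Qed.

Lemma independent_mul_ge0 (a b : T -> R) i j : i != j ->
  measurable_fun setT a -> measurable_fun setT b ->
  (forall x, 0 <= a x) -> (forall x, 0 <= b x) ->
  (\int[P]_w (a (X i w) * b (X j w))%:E =
   (\int[P]_w (a (X i w))%:E) * (\int[P]_w (b (X j w))%:E))%E.
Proof.
move=> ij ma mb a0 b0; pose F (z : T * T) := (a z.1 * b z.2)%:E.
have mF : measurable_fun setT F.
  by apply/measurable_EFinP; apply: measurable_funM; exact: measurableT_comp.
have F0 z : (0 <= F z)%E by rewrite lee_fin mulr_ge0.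
rewrite (independent_fubini (mX i) (mX j) _ mF F0); last first.
  by move=> A B mA mB; exact: independent_pair.
have mbX : measurable_fun setT (fun w => (b (X j w))%:E).
  by apply/measurable_EFinP; exact: measurableT_comp.
transitivity (\int[P]_w ((a (X i w))%:E * \int[P]_w' (b (X j w'))%:E))%E.
  apply: eq_integral => w _; rewrite /F /=; under eq_integral do rewrite EFinM.
  by rewrite ge0_integralZl// ?lee_fin// => w' _; rewrite lee_fin.
rewrite ge0_integralZr//.
- by apply/measurable_EFinP; exact: measurableT_comp.
- by move=> w _; rewrite lee_fin.
- by apply: integral_ge0 => w _; rewrite lee_fin.
Qed.

Lemma independent_mul (f : T -> R) i j : i != j -> measurable_fun setT f ->
  L2 P (f \o X i) -> L2 P (f \o X j) ->
  \int[P]_w (f (X i w) * f (X j w)) = \int[P]_w f (X i w) * \int[P]_w f (X j w).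
Proof.
move=> ij mf fi fj.
pose a x := Num.max (f x) 0; pose b x := Num.max (- f x) 0.
have ma : measurable_fun setT a by apply: measurable_maxr => //; exact: measurable_cst.
have mb : measurable_fun setT b.
  by apply: measurable_maxr; [exact: measurableT_comp|exact: measurable_cst].
have a0 x : 0 <= a x by rewrite /a le_max lexx orbT.
have b0 x : 0 <= b x by rewrite /b le_max lexx orbT.
have ab x : f x = a x - b x.
  rewrite /a /b; case/orP: (le_total 0 (f x)) => h.
    by rewrite max_l// max_r ?oppr_le0// subr0.
  by rewrite max_r// max_l ?oppr_ge0// sub0r opprK.
have dom (c : T -> R) k : (c = a) \/ (c = b) -> L2 P (f \o X k) -> L2 P (c \o X k).
  move=> hc fk; have mc : measurable_fun setT c by case: hc => ->.
  apply: L2_of_integrable; first exact: measurableT_comp.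
  apply: (integrable_dominated _ (L2_sqr_integrable fk)).
    by apply: measurable_funX; exact: measurableT_comp.
  move=> w /=; rewrite ger0_norm ?sqr_ge0//.
  case/orP: (le_total 0 (f (X k w))) => h; case: hc => ->; rewrite /a /b.
  - by rewrite max_l.
  - by rewrite max_r ?oppr_le0// expr0n sqr_ge0.
  - by rewrite max_r// expr0n sqr_ge0.
  - by rewrite max_l ?oppr_ge0// sqrrN.
have main (c e : T -> R) : (c = a) \/ (c = b) -> (e = a) \/ (e = b) ->
    P.-integrable setT (EFin \o (fun w => c (X i w) * e (X j w))) /\
    \int[P]_w (c (X i w) * e (X j w)) = \int[P]_w c (X i w) * \int[P]_w e (X j w).
  move=> hc he; have ci := dom _ _ hc fi; have ej := dom _ _ he fj.
  split; first exact: L2M_integrable ci ej.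
  rewrite /Rintegral independent_mul_ge0//.
  - by rewrite fineM//; apply: integrable_fin_num => //; exact: L2_integrable.
  - by case: hc => ->.
  - by case: he => ->.
  - by case: hc => ->.
  - by case: he => ->.
have la : a = a \/ a = b by left. have lb : b = a \/ b = b by right.
have [iaa Eaa] := main _ _ la la; have [iab Eab] := main _ _ la lb.
have [iba Eba] := main _ _ lb la; have [ibb Ebb] := main _ _ lb lb.
have L k : L2 P (f \o X k) -> \int[P]_w f (X k w) = \int[P]_w a (X k w) - \int[P]_w b (X k w).
  move=> fk; rewrite -RintegralB//; first by apply: eq_Rintegral => w _; rewrite ab.
    exact: L2_integrable (dom _ _ la fk).
  exact: L2_integrable (dom _ _ lb fk).
rewrite (L i fi) (L j fj).
transitivity (\int[P]_w ((a (X i w) * a (X j w) + b (X i w) * b (X j w)) +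
   (-1) * (a (X i w) * b (X j w) + b (X i w) * a (X j w)))).
  by apply: eq_Rintegral => w _; rewrite !ab; ring.
have i1 := integrable_addR iaa ibb; have i2 := integrable_addR iab iba.
rewrite RintegralD//; last exact: integrable_scaleR.
by rewrite RintegralZl// !RintegralD// Eaa Eab Eba Ebb; ring.
Qed.
End SecondMoment.

(** * The stratified sample of one level *)

Section StratifiedSample.
Context (R : realType) (d : measure_display) (T : measurableType d) (rho : probability T R)
  (psi : nat -> T -> R) (dO : measure_display) (Omega : measurableType dO)
  (P : probability Omega R) (n t : nat) (X : 'I_n * 'I_t -> Omega -> T).
Hypothesis onb : ONB rho psi.
Hypothesis psi_neq0 : forall x : T, exists2 i, (i < n)%N & psi i x != 0.
Hypotheses (n0 : (0 < n)%N) (t0 : (0 < t)%N).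
Hypothesis mX : forall i, measurable_fun setT (X i).
Hypothesis indX : independent P X.
Hypothesis lawX : forall i A, measurable A -> P (X i @^-1` A) = chi rho psi i.1 A.

Let mpsi i : measurable_fun setT (psi i). Proof. by case: onb. Qed.
Let sgt0 x : 0 < sumsq psi n x. Proof. exact: sumsq_gt0. Qed.

Lemma psi_sqr_le_sumsq (i : 'I_n) x : psi i x ^+ 2 <= sumsq psi n x.
Proof.
by rewrite /sumsq (bigD1 i)//= lerDl; apply: sumr_ge0 => j _; exact: sqr_ge0.
Qed.

(** Each stratum has its own law [chi_j], but their densities add up to [sumsq]: summed over the
    strata, the sample has the same means as one drawn from the mixture. *)
Lemma stratified_mean (f : T -> R) : measurable_fun setT f ->
  rho.-integrable setT (EFin \o (fun x => f x * sumsq psi n x)) ->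
  (forall i, P.-integrable setT (EFin \o (f \o X i))) /\
  \sum_i \int[P]_w f (X i w) = t%:R * \int[rho]_x (f x * sumsq psi n x).
Proof.
move=> mf intf.
have intj (j : 'I_n) : rho.-integrable setT (EFin \o (fun x => f x * psi j x ^+ 2)).
  have ig : rho.-integrable setT (EFin \o (fun x => `|f x * sumsq psi n x|)).
    exact: (integrable_abse intf).
  apply: (integrable_dominated _ ig).
    by apply: measurable_funM => //; exact: measurable_funX.
  move=> x; rewrite !normrM; apply: ler_wpM2l => //.
  by rewrite -normrM -expr2 (ger0_norm (sqr_ge0 _)) gtr0_norm// psi_sqr_le_sumsq.
have law (i : 'I_n * 'I_t) := sample_law (mpsi i.1) (mX i) (lawX i) mf (intj i.1).
split=> [i|]; first exact: (law i).1.
under eq_bigr => i _ do rewrite (law i).2.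
rewrite -(pair_bigA _ (fun (j : 'I_n) (k : 'I_t) => \int[rho]_x (f x * psi j x ^+ 2))) /=.
under eq_bigr do rewrite sumr_const card_ord -mulr_natl.
rewrite -mulr_sumr; congr (_ * _); rewrite -(Rintegral_sum _ intj).2.
by apply: eq_Rintegral => x _; rewrite -mulr_sumr.
Qed.

Lemma mean_projmx_sum :
  \sum_i mean_mx P (projmx psi n \o X i) = t%:R%:M :> 'M[R]_n.
Proof.
apply/matrixP => p q; rewrite summxE.
pose f x := projmx psi n x p q.
have fE x : f x * sumsq psi n x = psi p x * psi q x.
  by rewrite /f mxE mulfVK// lt0r_neq0.
have mf : measurable_fun setT f by exact: measurable_projmx.
have intf : rho.-integrable setT (EFin \o (fun x => f x * sumsq psi n x)).
  by under eq_fun do rewrite fE; apply: L2M_integrable; exact: ONB_L2.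
transitivity (\sum_i \int[P]_w f (X i w)); first by apply: eq_bigr => i _; rewrite mxE.
rewrite (stratified_mean mf intf).2 (_ : \int[rho]_x _ = (p == q)%:R).
  by rewrite mxE mulr_natr.
transitivity (\int[rho]_x (psi p x * psi q x)); first by apply: eq_Rintegral => x _.
by rewrite ONB_Rintegral.
Qed.

Definition sample_gram (w : Omega) : 'M[R]_n :=
  t%:R^-1 *: \sum_i projmx psi n (X i w).

Lemma sample_gram_sym w : (sample_gram w)^T = sample_gram w.
Proof.
rewrite linearZ /= linear_sum /=; congr (_ *: _); apply: eq_bigr => i _.
by case: (projmx_proj psi_neq0 (X i w)).
Qed.

Lemma measurable_sum_projmx : measurable_mx (fun w => \sum_i projmx psi n (X i w)).
Proof.
apply: measurable_mx_sum => i _ p q.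
exact: measurableT_comp (measurable_projmx psi_neq0 mpsi p q) (mX i).
Qed.

Lemma measurable_gram_good :
  measurable [set w | specnorm (sample_gram w - 1%:M) <= 2^-1].
Proof.
apply: measurable_specnorm_half => //.
  apply: measurable_mx_add; last exact: measurable_mx_cst.
  exact: measurable_mx_scale measurable_sum_projmx.
by move=> w; rewrite linearB /= trmx1 sample_gram_sym.
Qed.

Lemma sample_gram_tail :
  (P [set w | ~ (specnorm (sample_gram w - 1%:M) <= 2^-1)%R] <=
   (n%:R * expR (- theta * t%:R) + n%:R * expR (- theta_low * t%:R))%:E)%E.
Proof.
have pQ := projmx_proj psi_neq0; have mQ := measurable_projmx psi_neq0 mpsi.
apply: chernoff_specnorm => //; first exact: measurable_sum_projmx.
- move=> w; rewrite linear_sum /=; apply: eq_bigr => i _; by case: (pQ (X i w)).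
- by rewrite ltr0n.
- move=> lam; have := mgf_independent_sum mX indX lam mQ pQ (index_enum_uniq _) (trmx0 _ _ _).
  under eq_integral do rewrite add0r.
  move=> h; apply: le_trans h _; rewrite lee_fin add0r mean_projmx_sum scale_scalar_mx.
  have o1 : orth (1%:M : 'M[R]_n) by rewrite /orth trmx1 mulmx1.
  have -> : ((expR lam - 1) * t%:R)%:M = smx 1%:M (const_mx ((expR lam - 1) * t%:R)).
    by move=> m; rewrite /smx tr_scalar_mx mulmx1 mul1mx diag_const_mx.
  rewrite expm_smx// mxtrace_smx//; under eq_bigr do rewrite !mxE.
  by rewrite sumr_const card_ord mulr_natl.
Qed.

(** The vector [g] of the normal equations, taken for a general residual [r]. *)
Definition noise (r : T -> R) (w : Omega) (p : 'I_n) : R :=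
  (n * t)%:R^-1 * \sum_i weight psi n (X i w) * r (X i w) * psi p (X i w).

Lemma measurable_weight : measurable_fun setT (weight psi n).
Proof.
apply: measurable_funM; first exact: measurable_cst.
exact: measurable_sumsqV.
Qed.

(** Orthogonality of [r] to the basis makes the means cancel over the strata. Summing over [p] then
    uses that the squares [psi_p^2] add up to [sumsq], so the dimension disappears and only [1 / t]
    is left. *)
Lemma noise_second_moment (r : T -> R) : L2 rho r ->
  (forall p : 'I_n, \int[rho]_x (r x * psi p x) = 0) ->
  (forall p, L2 P (fun w => noise r w p)) /\
  \sum_(p < n) \int[P]_w (noise r w p ^+ 2) <= t%:R^-1 * \int[rho]_x (r x ^+ 2).
Proof.
move=> hr rpsi; pose f (p : 'I_n) x := weight psi n x * r x * psi p x.
have mr : measurable_fun setT r by case: hr.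
have mf p : measurable_fun setT (f p).
  by apply: measurable_funM => //; apply: measurable_funM => //; exact: measurable_weight.
have fs p x : f p x * sumsq psi n x = n%:R * (r x * psi p x).
  by rewrite /f /weight -/(sumsq psi n x); field; exact: lt0r_neq0.
have f2s p x : f p x ^+ 2 * sumsq psi n x =
    n%:R ^+ 2 * (r x ^+ 2 * (psi p x ^+ 2 / sumsq psi n x)).
  by rewrite /f /weight -/(sumsq psi n x); field; exact: lt0r_neq0.
have int1 p : rho.-integrable setT (EFin \o (fun x => f p x * sumsq psi n x)).
  under eq_fun do rewrite fs; apply: integrable_scaleR; apply: L2M_integrable => //.
  exact: ONB_L2.
have int2 p : rho.-integrable setT (EFin \o (fun x => f p x ^+ 2 * sumsq psi n x)).
  have ig := integrable_scaleR (n%:R ^+ 2) (L2_sqr_integrable hr).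
  apply: (integrable_dominated _ ig).
    apply: measurable_funM; first exact: measurable_funX.
    exact: measurable_sumsq.
  move=> x; rewrite f2s ger0_norm; last first.
    apply: mulr_ge0; [exact: sqr_ge0|apply: mulr_ge0; [exact: sqr_ge0|]].
    by apply: divr_ge0; [exact: sqr_ge0|exact: ltW].
  rewrite ler_wpM2l ?sqr_ge0// -[leRHS]mulr1 ler_wpM2l ?sqr_ge0// ler_pdivrMr// mul1r.
  exact: psi_sqr_le_sumsq.
have mf2 p : measurable_fun setT (fun x => f p x ^+ 2) by exact: measurable_funX.
have E1 p := (stratified_mean (mf p) (int1 p)).2.
have s2 p := stratified_mean (mf2 p) (int2 p).
have hf p i : L2 P (f p \o X i).
  by apply: L2_of_integrable; [exact: measurableT_comp|exact: (s2 p).1].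
have hsum p : L2 P (fun w => \sum_i f p (X i w)) by apply: L2_sum => i; exact: hf.
split=> [p|]; first exact: (L2Z (n * t)%:R^-1 (hsum p)).
have nt0 : (n * t)%:R != 0 :> R by rewrite pnatr_eq0 -lt0n muln_gt0 n0.
have bound p : \int[P]_w (noise r w p ^+ 2) <=
    (n * t)%:R^-1 ^+ 2 * (t%:R * \int[rho]_x (f p x ^+ 2 * sumsq psi n x)).
  rewrite (_ : \int[P]_w _ = (n * t)%:R^-1 ^+ 2 * \int[P]_w ((\sum_i f p (X i w)) ^+ 2)).
    rewrite -(s2 p).2 ler_wpM2l ?sqr_ge0//.
    apply: (uncorrelated_second_moment (hf p)).
      by move=> i j ij; exact: (independent_mul mX indX ij (mf p) (hf p i) (hf p j)).
    rewrite E1; rewrite (_ : \int[rho]_x _ = 0) ?mulr0//.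
    transitivity (\int[rho]_x (n%:R * (r x * psi p x))); first by apply: eq_Rintegral => x _.
    rewrite RintegralZl// ?rpsi ?mulr0//; apply: L2M_integrable => //; exact: ONB_L2.
  rewrite -RintegralZl//; last exact: L2_sqr_integrable.
  by apply: eq_Rintegral => w _; rewrite exprMn.
apply: le_trans (ler_sum _ (fun p _ => bound p)) _.
rewrite -mulr_sumr -mulr_sumr -(Rintegral_sum _ int2).2.
rewrite (_ : \int[rho]_x _ = n%:R ^+ 2 * \int[rho]_x (r x ^+ 2)); last first.
  rewrite -RintegralZl//; last exact: L2_sqr_integrable.
  apply: eq_Rintegral => x _; under eq_bigr do rewrite f2s.
  rewrite -!mulr_sumr -mulr_suml -/(sumsq psi n x) divff ?mulr1//.
  exact: lt0r_neq0.
rewrite le_eqVlt; apply/orP; left; apply/eqP; rewrite natrM; field.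
by rewrite !pnatr_eq0 -!lt0n n0 t0.
Qed.
End StratifiedSample.

(** * Deterministic analysis of discrete least squares *)

Section LeastSquares.
Context (R : realType) (d : measure_display) (T : measurableType d)
  (psi : nat -> T -> R) (n t : nat) (x : nat -> nat -> T).
Hypothesis psi_neq0 : forall y : T, exists2 i, (i < n)%N & psi i y != 0.
Hypothesis n0 : (0 < n)%N.

Definition dinner (f g : T -> R) : R :=
  (n * t)%:R^-1 * \sum_(j < n) \sum_(k < t) weight psi n (x j k) * f (x j k) * g (x j k).

Lemma weight_ge0 y : 0 <= weight psi n y.
Proof. by rewrite /weight divr_ge0// sumr_ge0// => i _; exact: sqr_ge0. Qed.

Lemma dnorm2_perturb (f g : T -> R) (s : R) :
  dnorm2 psi n t x (fun y => f y - s * g y) =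
  dnorm2 psi n t x f - 2 * s * dinner f g + s ^+ 2 * dnorm2 psi n t x g.
Proof.
rewrite /dnorm2 /dinner mulrCA [s ^+ 2 * _]mulrCA -mulrBr -mulrDr; congr (_ * _).
rewrite !pair_bigA /= !mulr_sumr -sumrB -big_split /=; apply: eq_bigr => -[j k] _ /=.
ring.
Qed.

Lemma dnorm2_ge0 (f : T -> R) : 0 <= dnorm2 psi n t x f.
Proof.
rewrite /dnorm2 mulr_ge0 ?invr_ge0//; apply: sumr_ge0 => j _; apply: sumr_ge0 => k _.
by rewrite mulr_ge0 ?sqr_ge0 ?weight_ge0.
Qed.

(** Changing the single coefficient [p] by [s] changes the discrete norm by a quadratic in [s] that
    is never negative, so its linear part vanishes. *)
Lemma minimizer_ortho (u : T -> R) (c : nat -> R) (p : 'I_n) :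
  (forall c', dnorm2 psi n t x (fun y => u y - spanf psi n c y) <=
              dnorm2 psi n t x (fun y => u y - spanf psi n c' y)) ->
  dinner (fun y => u y - spanf psi n c y) (psi p) = 0.
Proof.
move=> cmin; set f := fun y => u y - spanf psi n c y.
have h (s : R) : 0 <= s * (- 2 * dinner f (psi p)) + dnorm2 psi n t x (psi p) * s ^+ 2.
  pose c' i := c i + s * (i == p :> nat)%:R; have := cmin c'.
  rewrite (_ : (fun y => u y - spanf psi n c' y) = fun y => f y - s * psi p y).
    by rewrite dnorm2_perturb -/f; lra.
  apply/funext => y; rewrite /f -addrA; congr (_ + _); rewrite -opprD; congr (- _).
  rewrite /spanf; under eq_bigr do rewrite mulrDl.
  rewrite big_split /=; congr (_ + _); rewrite (bigD1 p)//= eqxx mulr1 big1 ?addr0// => i ip.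
  by rewrite (_ : (i == p :> nat) = false) ?mulr0 ?mul0r//; exact/negbTE.
have /eqP : - 2 * dinner f (psi p) = 0.
  by apply: (@quadratic_perturbation R _ _ 1 ltr01 (dnorm2_ge0 (psi p))) => s _.
by rewrite mulf_eq0 oppr_eq0 pnatr_eq0 /= => /eqP.
Qed.

Lemma dinner_spanf (r : T -> R) (e : nat -> R) (p : 'I_n) :
  dinner (fun y => r y - spanf psi n e y) (psi p) =
  dinner r (psi p) - \sum_(q < n) gram psi n t x p q * e q.
Proof.
have -> : \sum_(q < n) gram psi n t x p q * e q = dinner (spanf psi n e) (psi p).
  rewrite /dinner; under eq_bigr do rewrite mxE -mulrA mulr_suml.
  rewrite -mulr_sumr; congr (_ * _); rewrite exchange_big /=; apply: eq_bigr => j _.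
  under eq_bigr do rewrite mulr_suml.
  rewrite exchange_big /=; apply: eq_bigr => k _; rewrite /spanf mulr_sumr mulr_suml.
  by apply: eq_bigr => q _; ring.
rewrite /dinner -mulrBr; congr (_ * _); rewrite !pair_bigA /= -sumrB.
by apply: eq_bigr => -[j k] _ /=; ring.
Qed.

Lemma least_squares_bound (r : T -> R) (e : nat -> R) :
  specnorm (gram psi n t x - 1%:M) <= 2^-1 ->
  (forall p : 'I_n, dinner (fun y => r y - spanf psi n e y) (psi p) = 0) ->
  \sum_(i < n) e i ^+ 2 <= 4 * \sum_(p < n) dinner r (psi p) ^+ 2.
Proof.
move=> good ortho.
have Ge (p : 'I_n) : \sum_(q < n) gram psi n t x p q * e q = dinner r (psi p).
  by have := ortho p; rewrite dinner_spanf => /eqP; rewrite subr_eq0 => /eqP.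
have sG : (gram psi n t x - 1%:M)^T = gram psi n t x - 1%:M.
  rewrite linearB /= trmx1; congr (_ - _); apply/matrixP => p q; rewrite !mxE.
  by congr (_ * _); apply: eq_bigr => j _; apply: eq_bigr => k _; ring.
pose v : 'cV[R]_n := \col_i e i.
have half0 : 0 <= 2^-1 :> R by rewrite invr_ge0.
have := specnorm_bound v sG n0 half0 good.
rewrite -(@ler_pXn2r _ 2)// ?nnegrE ?mulr_ge0 ?eucl_ge0// exprMn !sqr_eucl.
rewrite (_ : \sum_i ((gram psi n t x - 1%:M) *m v) i 0 ^+ 2 =
   \sum_(i < n) (dinner r (psi i) - e i) ^+ 2); last first.
  apply: eq_bigr => i _; congr (_ ^+ 2); rewrite mulmxBl mul1mx mxE [in X in _ + X]mxE.
  by rewrite -Ge mxE [v i 0]mxE; congr (_ - _); apply: eq_bigr => q _; rewrite [v q 0]mxE.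
rewrite (_ : \sum_i v i 0 ^+ 2 = \sum_(i < n) e i ^+ 2); last first.
  by apply: eq_bigr => i _; rewrite mxE.
(* With $g = G e$ the good event says $|g - e|^2 \le |e|^2 / 4$. The square expands to $|g|^2 + |g -
   e|^2 - |e|^2 / 2$, whence $|e|^2 \le 4 |g|^2$. *)
have : 0 <= \sum_(i < n) 2 * (dinner r (psi i) - e i / 2) ^+ 2.
  by apply: sumr_ge0 => i _; rewrite mulr_ge0 ?sqr_ge0.
rewrite (_ : \sum_(i < n) 2 * (dinner r (psi i) - e i / 2) ^+ 2 =
   \sum_(i < n) dinner r (psi i) ^+ 2 + \sum_(i < n) (dinner r (psi i) - e i) ^+ 2
    - 2^-1 * \sum_(i < n) e i ^+ 2); first lra.
by rewrite mulr_sumr -big_split -sumrB /=; apply: eq_bigr => i _; field.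
Qed.
End LeastSquares.

Lemma gram_dim1 (R : realType) (d : measure_display) (T : measurableType d)
  (psi : nat -> T -> R) (n t : nat) (x : nat -> nat -> T) : n = 1%N -> (0 < t)%N ->
  (forall y : T, exists2 i, (i < n)%N & psi i y != 0) ->
  specnorm (gram psi n t x - 1%:M) <= 2^-1.
Proof.
move=> -> t0 psi_neq0.
have -> : gram psi 1 t x = 1%:M.
  apply/matrixP => p q; rewrite !ord1 !mxE eqxx big_ord1 mul1n.
  under eq_bigr => k _.
    rewrite /weight big_ord1 mul1r -mulrA -expr2 mulVf; last first.
      by have [[|i]// _] := psi_neq0 (x 0 k); rewrite sqrf_eq0.
    over.
  by rewrite sumr_const card_ord mulVf// pnatr_eq0 -lt0n.
rewrite subrr; have o1 : orth (1%:M : 'M[R]_1) by rewrite /orth trmx1 mulmx1.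
have -> : (0 : 'M[R]_1) = smx 1%:M 0 by rewrite /smx linear0 mulmx0 mul0mx.
by apply/specnorm_smx_leP; rewrite ?invr_ge0// => i; rewrite mxE normr0 invr_ge0.
Qed.

(** * Tail and risk bounds for one level within the full array of samples *)

Section Level.
Context (R : realType) (d : measure_display) (T : measurableType d) (rho : probability T R)
  (psi : nat -> T -> R) (dO : measure_display) (Omega : measurableType dO)
  (P : probability Omega R) (n t N M : nat) (Y : nat -> nat -> Omega -> T).
Hypothesis onb : ONB rho psi.
Hypothesis psi_neq0 : forall x : T, exists2 i, (i < n)%N & psi i x != 0.
Hypotheses (n0 : (0 < n)%N) (t0 : (0 < t)%N) (nN : (n <= N)%N) (tM : (t <= M)%N).
Hypothesis mY : forall j k, (j < N)%N -> (k < M)%N -> measurable_fun setT (Y j k).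
Hypothesis indY : independent P (fun i : 'I_N * 'I_M => Y i.1 i.2).
Hypothesis lawY : forall j k (A : set T), (j < N)%N -> (k < M)%N ->
  measurable A -> P (Y j k @^-1` A) = chi rho psi j A.

(** The level sees the corner [n] by [t] of the array [N] by [M] drawn for the finest level. *)
Definition level_sample (i : 'I_n * 'I_t) : Omega -> T := Y i.1 i.2.
Let X := level_sample.

Definition level_good (w : Omega) : Prop :=
  specnorm (gram psi n t (fun j k => Y j k w) - 1%:M) <= 2^-1.

Let mX i : measurable_fun setT (X i).
Proof. by apply: mY; [exact: leq_trans nN|exact: leq_trans tM]. Qed.

Let indX : independent P X.
Proof.
pose h (i : 'I_n * 'I_t) := (widen_ord nN i.1, widen_ord tM i.2).
have hinj : injective h.
  move=> [i1 i2] [j1 j2] e; congr (_, _); apply: val_inj.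
    exact: (congr1 (fun z => val z.1) e).
  exact: (congr1 (fun z => val z.2) e).
exact: (independent_inj hinj indY).
Qed.

Let lawX i A : measurable A -> P (X i @^-1` A) = chi rho psi i.1 A.
Proof. by move=> mA; apply: lawY => //; [exact: leq_trans nN|exact: leq_trans tM]. Qed.

Let gramE w : gram psi n t (fun j k => Y j k w) = sample_gram psi X w.
Proof. exact: gram_projmx. Qed.

Lemma measurable_level_good : measurable [set w | level_good w].
Proof.
rewrite (_ : [set w | level_good w] = [set w | specnorm (sample_gram psi X w - 1%:M) <= 2^-1]).
  exact: (measurable_gram_good onb).
by apply/seteqP; split => w /=; rewrite /level_good gramE.
Qed.

Lemma level_tail : (P [set w | ~ level_good w] <=
   (n%:R * expR (- theta * t%:R) + n%:R * expR (- theta_low * t%:R))%:E)%E.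
Proof.
rewrite (_ : [set w | ~ level_good w] =
    [set w | ~ (specnorm (sample_gram psi X w - 1%:M) <= 2^-1)%R]).
  exact: (sample_gram_tail onb psi_neq0 n0 t0 mX indX lawX).
by apply/seteqP; split => w /=; rewrite /level_good gramE.
Qed.

Lemma level_risk (u : T -> R) (uW : Omega -> nat -> R) : L2 rho u ->
  (forall w, level_good w -> forall c : nat -> R,
     dnorm2 psi n t (fun j k => Y j k w) (fun x => u x - spanf psi n (uW w) x)
     <= dnorm2 psi n t (fun j k => Y j k w) (fun x => u x - spanf psi n c x)) ->
  (\int[P]_w (\int[rho]_x ((u x - (if `[< level_good w >] then spanf psi n (uW w) x else 0))
       ^+ 2)%:E)
   <= ((1 + 4 / t%:R) * \int[rho]_x (residual rho psi n u x ^+ 2)%R)%:E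
      + (\int[rho]_x (u x ^+ 2)%R)%:E * P [set w | ~ level_good w])%E.
Proof.
move=> hu uWmin; pose r := residual rho psi n u.
have hr : L2 rho r by exact: residual_L2.
have rpsi (p : 'I_n) : \int[rho]_x (r x * psi p x) = 0 by exact: residual_ortho.
have [hg Eg] := noise_second_moment onb psi_neq0 n0 t0 mX indX lawX hr rpsi.
set E := Rintegral rho setT (fun x => residual rho psi n u x ^+ 2) in Eg *.
set U := Rintegral rho setT (fun x => u x ^+ 2).
have E0 : 0 <= E by apply: Rintegral_ge0 => x _; exact: sqr_ge0.
have U0 : 0 <= U by apply: Rintegral_ge0 => x _; exact: sqr_ge0.
pose g w p := noise psi X r w p.
pose B := [set w | ~ level_good w].
have mB : measurable B by apply: measurableC; exact: measurable_level_good.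
have gE w (p : 'I_n) : dinner psi n t (fun j k => Y j k w) r (psi p) = g w p.
  by rewrite /dinner /g /noise pair_bigA.
(* A measurable majorant of the squared error: residual plus four times the noise on the good event,
   the squared norm of [u] on the bad one. The noise is kept on all of [Omega], where its mean is
   known. *)
apply: (@le_trans _ _ (\int[P]_w ((E + 4 * \sum_(p < n) g w p ^+ 2)%:E + U%:E * (\1_B w)%:E))%E).
  apply: ge0_le_integralW => w; first by apply: integral_ge0 => x _; rewrite lee_fin sqr_ge0.
  have S0 : 0 <= \sum_(p < n) g w p ^+ 2 by apply: sumr_ge0 => p _; exact: sqr_ge0.
  rewrite -EFinM -EFinD; case: (asboolP (level_good w)) => gw.
    have hL : L2 rho (fun x => u x - spanf psi n (uW w) x).
      have := L2D hu (L2Z (-1) (spanf_L2 n (uW w) onb)).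
      by under eq_fun do rewrite mulN1r.
    rewrite (L2_integralE hL) lee_fin pythagoras// -/E.
    have -> : \1_B w = 0 :> R by rewrite indicE memNset.
    rewrite mulr0 addr0 lerD2l (eq_bigr _ (fun p _ => congr1 (fun y => y ^+ 2) (esym (gE w p)))).
    apply: (@least_squares_bound _ _ _ psi n t _ n0 r (fun i => uW w i - fourier rho psi u i)) => // p.
    rewrite (_ : (fun y => r y - _) = fun y => u y - spanf psi n (uW w) y).
      by apply: minimizer_ortho => c; exact: uWmin.
    apply/funext => y; rewrite /r /residual -addrA; congr (_ + _); rewrite -opprD; congr (- _).
    by rewrite /spanf -big_split; apply: eq_bigr => i _ /=; rewrite -mulrDl addrC subrK.
  under eq_integral do rewrite subr0.
  rewrite (L2_integralE hu) lee_fin -/U indicE mem_set// mulr1 lerDr.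
  by rewrite addr_ge0// mulr_ge0.
have ig p : P.-integrable setT (EFin \o (fun w => g w p ^+ 2)).
  by apply: L2_sqr_integrable; exact: hg.
have [is1 Es] := Rintegral_sum (index_enum 'I_n) ig.
have is4 := integrable_scaleR 4 is1.
have iE : P.-integrable setT (EFin \o (fun=> E)) by exact: finite_measure_integrable_cst.
have is5 := integrable_addR iE is4.
rewrite ge0_integralD//; last 4 first.
- move=> w _; rewrite lee_fin addr_ge0// mulr_ge0// sumr_ge0// => p _; exact: sqr_ge0.
- by case/integrableP: is5.
- by move=> w _; rewrite mule_ge0// lee_fin.
- by apply: emeasurable_funM; [exact: measurable_cst|exact/measurable_EFinP/measurable_indic].
apply: leeD.
  rewrite -[leLHS]fineK; last exact: integrable_fin_num is5.
  rewrite lee_fin -/(Rintegral P setT (fun w => E + 4 * \sum_(p < n) g w p ^+ 2)).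
  rewrite RintegralD// RintegralZl// Rintegral_prob_cst Es [leRHS]mulrDl mul1r lerD2l -mulrA.
  by rewrite ler_pM2l.
rewrite ge0_integralZl ?integral_indic ?setIT// ?lee_fin//.
exact/measurable_EFinP/measurable_indic.
Qed.
End Level.

(** * Union bound over the levels and conclusion *)

Unset Implicit Arguments.
Set Strict Implicit.

Theorem theorem3 (R : realType) (d : measure_display) (T : measurableType d)
  (rho : probability T R) (psi : nat -> T -> R)
  (dO : measure_display) (Omega : measurableType dO) (P : probability Omega R)
  (alpha s : R) (K : nat) (n : nat -> nat) (Y : nat -> nat -> Omega -> T) :
  ONB rho psi ->
  (forall x : T, exists2 i, (i < n 0)%N & psi i x != 0) ->
  0 < alpha < 1 -> 1 < s -> (0 < K)%N ->
  (forall k, (k.+1 < K)%N -> (n k < n k.+1)%N) ->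
  (forall j t, (j < n K.-1)%N -> (t < tau s alpha (n K.-1))%N ->
     measurable_fun setT (Y j t)) ->
  independent P (fun i : 'I_(n K.-1) * 'I_(tau s alpha (n K.-1)) => Y i.1 i.2) ->
  (forall j t (A : set T), (j < n K.-1)%N -> (t < tau s alpha (n K.-1))%N ->
     measurable A -> P (Y j t @^-1` A) = chi rho psi j A) ->
  let G k w := gram psi (n k) (tau s alpha (n k)) (fun j t => Y j t w) in
  let good k w := specnorm (G k w - 1%:M) <= 2^-1 in
  (P [set w | forall k, (k < K)%N -> good k w] >= (1 - alpha)%:E)%E
  /\
  (forall u : T -> R, L2 rho u ->
   forall uW : nat -> Omega -> nat -> R,
     (forall k w, (k < K)%N -> good k w ->
        forall c : nat -> R,
          dnorm2 psi (n k) (tau s alpha (n k)) (fun j t => Y j t w)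
                 (fun x => u x - spanf psi (n k) (uW k w) x)
          <= dnorm2 psi (n k) (tau s alpha (n k)) (fun j t => Y j t w)
                 (fun x => u x - spanf psi (n k) c x)) ->
     let uC k w x := if `[< good k w >] then spanf psi (n k) (uW k w) x else 0 in
     forall k, (k < K)%N ->
       (\int[P]_w (\int[rho]_x ((u x - uC k w x) ^+ 2)%:E)
        <= (1 + 4 * theta / ln (zeta s * ((n k)%:R `^ (s + 1)) / alpha))%:E
             * err2 rho psi (n k) u
           + alpha%:E * \int[rho]_x ((u x) ^+ 2)%:E)%E).
Proof.
move=> onb psi0 a01 s1 K0 nincr mY indY lawY G good.
have a0 : 0 < alpha by case/andP: a01.
(* A measurable type is pointed, and [psi0] at that point supplies an index below [n 0]. *)
have n0 : (0 < n 0)%N by have [j] := psi0 point; case: (n 0).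
have nmono k l : (k <= l)%N -> (l < K)%N -> (n k <= n l)%N.
  elim: l => [|l IH]; first by rewrite leqn0 => /eqP ->.
  rewrite leq_eqVlt ltnS => /orP[/eqP -> //|kl] lK.
  by apply: leq_trans (IH kl (ltnW lK)) _; exact/ltnW/nincr.
have nk0 k : (k < K)%N -> (0 < n k)%N by move=> kK; exact: leq_trans n0 (nmono _ _ _ kK).
have nkK k : (k < K)%N -> (n k <= n K.-1)%N.
  by move=> kK; apply: nmono; [rewrite -ltnS prednK|rewrite prednK].
have tk0 k : (k < K)%N -> (0 < tau s alpha (n k))%N by move=> kK; apply: tau_gt0 => //; exact: nk0.
have tkK k : (k < K)%N -> (tau s alpha (n k) <= tau s alpha (n K.-1))%N.
  by move=> kK; apply: tau_le => //; [exact: nk0|exact: nkK].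
have psik k : (k < K)%N -> forall x : T, exists2 i, (i < n k)%N & psi i x != 0.
  by move=> kK x; have [i i0 pi0] := psi0 x; exists i => //; exact: leq_trans i0 (nmono _ _ _ kK).
pose bad k := [set w | ~ good k w].
have mgood k : (k < K)%N -> measurable [set w | good k w].
  move=> kK; exact: (measurable_level_good onb (psik k kK) (nk0 k kK) (nkK k kK) (tkK k kK) mY).
have mbad k : (k < K)%N -> measurable (bad k) by move=> kK; apply: measurableC; exact: mgood.
(* A level of dimension 1 cannot fail, which matches the value 0 of [fail_bound] there. *)
have Pbad k : (k < K)%N -> (P (bad k) <= (fail_bound s alpha (n k))%:E)%E.
  move=> kK; have [n1|n1] := leqP (n k) 1.
    have nk1 : n k = 1%N by apply/eqP; rewrite eqn_leq n1 nk0.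
    rewrite (_ : bad k = set0) ?measure0 ?lee_fin ?fail_bound_ge0//.
    apply/seteqP; split => w //=; apply; exact: gram_dim1 nk1 (tk0 k kK) (psik k kK).
  apply: le_trans (level_tail onb (psik k kK) (nk0 k kK) (tk0 k kK) (nkK k kK) (tkK k kK)
    mY indY lawY) _.
  by rewrite lee_fin; exact: chernoff_le_fail_bound.
have Pall : (P (\big[setU/set0]_(k < K) bad k) <= alpha%:E)%E.
  have sumb m : (m <= K)%N ->
      (P (\big[setU/set0]_(k < m) bad k) <= (\sum_(k < m) fail_bound s alpha (n k))%:E)%E.
    elim: m => [|m IH] mK; first by rewrite !big_ord0 measure0.
    rewrite !big_ord_recr /= EFinD.
    have mU : measurable (\big[setU/set0]_(k < m) bad k).
      by apply: bigsetU_measurable => k _; apply: mbad; exact: ltn_trans (ltn_ord k) mK.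
    apply: le_trans (measureU2 _ mU (mbad m mK)) _.
    by apply: leeD; [exact/IH/ltnW|exact: Pbad].
  apply: le_trans (sumb K (leqnn K)) _; rewrite lee_fin.
  apply: le_trans (sum_fail_bound a01 s1 (n K.-1).+1).
  have := @sum_increasing_le R (fail_bound s alpha) n K.-1 (fail_bound_ge0 a01 s1) n0.
  rewrite prednK//; apply=> k kK; apply: nincr; move: kK; by rewrite -ltnS prednK.
split.
  have E : [set w | forall k, (k < K)%N -> good k w] = ~` (\big[setU/set0]_(k < K) bad k).
    rewrite -bigcup_mkord; apply/seteqP; split => w /=.
      by move=> h [k /= kK]; apply; exact: h.
    by move=> h k kK; apply: contrapT => ng; apply: h; exists k.
  have mU : measurable (\big[setU/set0]_(k < K) bad k).
    by apply: bigsetU_measurable => k _; exact: mbad.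
  by rewrite E probability_setC// EFinB; apply: leeB.
move=> u hu uW uWmin uC k kK.
have PbadA : (P (bad k) <= alpha%:E)%E.
  apply: le_trans Pall; apply: le_measure; rewrite ?inE; [exact: mbad| |exact: bigsetU_sup].
  by apply: bigsetU_measurable => l _; exact: mbad.
apply: le_trans (level_risk onb (psik k kK) (nk0 k kK) (tk0 k kK) (nkK k kK) (tkK k kK)
  mY indY lawY hu (fun w => uWmin k w kK)) _.
have lnB := ln_bound_arg_gt0 a01 s1 (nk0 k kK); have th0 := theta_gt0 R.
have E0 : 0 <= \int[rho]_x (residual rho psi (n k) u x ^+ 2).
  by apply: Rintegral_ge0 => x _; exact: sqr_ge0.
have c0 : 0 <= 1 + 4 * theta / ln (zeta s * (n k)%:R `^ (s + 1) / alpha).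
  by apply: addr_ge0 => //; apply: divr_ge0; [rewrite mulr_ge0// ltW|exact: ltW].
apply: leeD; last first.
  rewrite (L2_integralE hu) muleC lee_wpmul2r// lee_fin; apply: Rintegral_ge0 => x _.
  exact: sqr_ge0.
apply: (@le_trans _ _ ((1 + 4 * theta / ln (zeta s * (n k)%:R `^ (s + 1) / alpha))%:E *
   (\int[rho]_x (residual rho psi (n k) u x ^+ 2))%R%:E)%E); last first.
  by rewrite lee_wpmul2l ?lee_fin//; exact: err2_ge.
(* What remains is [1 / tau <= theta / ln (...)], the definition of [tau] as a ceiling. *)
rewrite -EFinM lee_fin ler_wpM2r// lerD2l -mulrA ler_pM2l// -[leRHS]invrK invf_div lef_pV2.
- by have := tau_ge a01 s1 (nk0 k kK); rewrite mulrC.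
- by rewrite posrE ltr0n tk0.
- by rewrite posrE divr_gt0.
Qed.
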